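(* Let $0\le\lambda<\gamma\le\delta$ and let $p\ge 1$. Then the equation $$r+4(\gamma-\lambda)\sum_{m=2}^{\infty}\frac{r^m}{m^2[2\gamma+(\delta-\gamma)(m-1)]}+\sum_{m=2}^{\infty}\left[\frac{4(\gamma-\lambda)r^m}{m^2[2\gamma+(\delta-\gamma)(m-1)]}\right]^p=1+4(\gamma-\lambda)\sum_{m=2}^{\infty}\frac{(-1)^{m-1}}{m^2[2\gamma+(\delta-\gamma)(m-1)]}$$ has a unique root $r_p(\gamma,\delta,\lambda)$ in $(0,1)$, and for every $f=h+\overline{g}\in R_H^0(\gamma,\delta,\lambda)$, $$|z|+\sum_{m=2}^{\infty}(|a_m|+|b_m|)|z|^m+\sum_{m=2}^{\infty}(|a_m|+|b_m|)^p|z|^{pm}\le d(f(0),\partial f(\mathbb{D}))$$ for $|z|=r\le r_p(\gamma,\delta,\lambda)$. The radius $r_p(\gamma,\delta,\lambda)$ is the best possible.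
   Context: $\mathbb{D}$ is the open unit disk in $\mathbb{C}$. $\mathcal{H}_0$ is the set of complex-valued harmonic functions $f=h+\overline{g}$ on $\mathbb{D}$ with $h,g$ analytic, $h(0)=h'(0)-1=0$, $g(0)=g'(0)=0$; write $h(z)=z+\sum_{m=2}^\infty a_mz^m$, $g(z)=\sum_{m=2}^\infty b_mz^m$. For $0\le\lambda<\gamma\le\delta$, $R_H^0(\gamma,\delta,\lambda)$ is the class of all $f=h+\overline{g}\in\mathcal{H}_0$ satisfying, for all $z\in\mathbb{D}$, $$\mathrm{Re}\left(\gamma h'(z)+\delta zh''(z)+\tfrac{\delta-\gamma}{2}z^2h'''(z)-\lambda\right)>\left|\gamma g'(z)+\delta zg''(z)+\tfrac{\delta-\gamma}{2}z^2g'''(z)\right|.$$ $d(f(0),\partial f(\mathbb{D}))$ is the Euclidean distance from $f(0)$ to the boundary of $f(\mathbb{D})$. A radius being the best possible means that it cannot be replaced by any larger number in such a way that the inequality still holds for all functions in the class. *)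

(* Defs.v *)
From mathcomp Require Import all_boot all_order all_algebra.
From mathcomp Require Import complex.
From mathcomp Require Import all_classical all_reals all_analysis.

Set Implicit Arguments.
Unset Strict Implicit.
Unset Printing Implicit Defensive.

Import Order.TTheory GRing.Theory Num.Theory.
Import numFieldNormedType.Exports.
Import Normc.

Local Open Scope classical_set_scope.
Local Open Scope ring_scope.
Local Open Scope complex_scope.

(* The regular module R[i]^o carries the topology of the complex modulus, and
   derivatives of maps R[i]^o -> R[i]^o are complex derivatives. The modulus
   is taken through normc because `|z| has values in R[i]. *)
Definition unit_disk (R : realType) : set R[i]^o := [set z | normc z < 1].

Definition analytic_on_disk (R : realType) (h : R[i]^o -> R[i]^o) : Prop :=
  forall z : R[i]^o, unit_disk z -> derivable h z 1.

Definition harmonic_H0 (R : realType) (f h g : R[i]^o -> R[i]^o) : Prop :=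
  [/\ forall z : R[i]^o, unit_disk z -> f z = h z + conjc (g z),
      analytic_on_disk h, analytic_on_disk g,
      h 0 = 0 /\ h^`()%classic 0 - 1 = 0
    & g 0 = 0 /\ g^`()%classic 0 = 0].

Definition third_order_op (R : realType) (gamma delta : R)
    (h : R[i]^o -> R[i]^o) (z : R[i]^o) : R[i] :=
  gamma%:C * h^`()%classic z + delta%:C * z * h^`(2)%classic z
    + ((delta - gamma) / 2)%:C * z ^+ 2 * h^`(3)%classic z.

Definition class_RH0 (R : realType) (gamma delta lambda : R)
    (f h g : R[i]^o -> R[i]^o) : Prop :=
  harmonic_H0 f h g /\
  forall z : R[i]^o, unit_disk z ->
    complex.Re (third_order_op gamma delta h z - lambda%:C)
      > normc (third_order_op gamma delta g z).

(* h(z) = c z + \sum_(m >= 2) a_m z^m on the unit disk; a 0 and a 1 are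
   not used. *)
Definition power_coefs (R : realType) (c : R[i]) (a : nat -> R[i])
    (h : R[i]^o -> R[i]^o) : Prop :=
  forall z : R[i]^o, unit_disk z ->
    (fun n : nat => c * z + \sum_(2 <= m < n) a m * z ^+ m : R[i]^o) @ \oo
      --> h z.

Definition boundary (T : topologicalType) (S : set T) : set T :=
  closure S `\` interior S.

(* Valued in \bar R: the distance to the empty set is +oo. *)
Definition dist_to (R : realType) (w : R[i]^o) (S : set R[i]^o) : \bar R :=
  ereal_inf [set (normc (v - w))%:E | v in S].

Definition denom (R : realType) (gamma delta : R) (m : nat) : R :=
  m%:R ^+ 2 * (2 * gamma + (delta - gamma) * (m%:R - 1)).

(* Infinite sums are limits of partial sums in \bar R, so that a divergent
   series of nonnegative terms is +oo. *)
Definition radius_equation (R : realType) (gamma delta lambda p r : R) : Prop :=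
  (r%:E
    + (4 * (gamma - lambda))%:E
      * (\sum_(2 <= m <oo) (r ^+ m / denom gamma delta m)%:E)
    + \sum_(2 <= m <oo)
        ((4 * (gamma - lambda) * r ^+ m / denom gamma delta m) `^ p)%:E
  = 1
    + (4 * (gamma - lambda))%:E
      * (\sum_(2 <= m <oo) ((- 1) ^+ m.-1 / denom gamma delta m)%:E))%E.

Definition is_radius_root (R : realType) (gamma delta lambda p r : R) : Prop :=
  0 < r < 1 /\ radius_equation gamma delta lambda p r.

Definition bohr_inequality (R : realType) (p : R) (f : R[i]^o -> R[i]^o)
    (a b : nat -> R[i]) (z : R[i]^o) : Prop :=
  ((normc z)%:E
    + \sum_(2 <= m <oo) ((normc (a m) + normc (b m)) * normc z ^+ m)%:E
    + \sum_(2 <= m <oo)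
        ((normc (a m) + normc (b m)) `^ p * normc z `^ (p * m%:R))%:E
  <= dist_to (f 0%R) (boundary (f @` unit_disk (R := R))%classic))%E.

Definition bohr_holds_up_to (R : realType) (gamma delta lambda p rho : R)
    : Prop :=
  forall (f h g : R[i]^o -> R[i]^o) (a b : nat -> R[i]),
    class_RH0 gamma delta lambda f h g ->
    power_coefs 1 a h -> power_coefs 0 b g ->
    forall z : R[i]^o, unit_disk z -> normc z <= rho ->
      bohr_inequality p f a b z.

(* Main.v *)
Require Import Defs.
From mathcomp Require Import all_boot all_order all_algebra.
From mathcomp Require Import complex.
From mathcomp Require Import all_classical all_reals all_analysis.
From mathcomp Require Import ring lra separable.
From mathcomp Require cyclic cyclotomic.

Set Implicit Arguments.
Unset Strict Implicit.
Unset Printing Implicit Defensive.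

Import Order.TTheory GRing.Theory Num.Theory.
Import numFieldNormedType.Exports.
Import Normc.

Local Open Scope classical_set_scope.
Local Open Scope ring_scope.
Local Open Scope complex_scope.

(** Let [theta] be [z d/dz] and [kap] be [(delta - gamma) / 2]. On power series
    the third-order operator [T] of the class is diagonal: writing
    [F z = z * (sum of E_k z^k)], it multiplies [E_k] by
    [(k + 1)^2 (gamma + kap k)], which is half of [denom (k + 1)]; in other
    words [T] acts on [F z / z] as [(1 + theta)^2 (gamma + kap theta)].

    For every unimodular [u] the analytic function [F = h + u g] satisfies
    [Re (T F) > lambda] on the disk, and [T F] takes the value [gamma] at 0.
    Three consequences are drawn from this.

    - Caratheodory's inequality for [T F - lambda] bounds the coefficients of
      [F]; choosing [u] to align [a_m] with [u b_m] bounds [|a_m| + |b_m|] by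
      [4 (gamma - lambda) / denom m] ([class_coef_le]).
    - Harnack's inequality for [T F - lambda] compares [Re (T F)] on a ray with
      the image under [T] of an extremal function. An inequality
      [(al + ka theta) S >= 0] along a ray implies [S >= 0] ([averaging_ge0]),
      so the three first-order factors of [T] can be removed one after the
      other, which compares [Re (F z / z)] with the extremal function. At
      [z = t w], with [u = w^2], this reads [Re (conjc w * f (t w)) >= L t]
      ([class_growth]); and [L t] increases, as [t] tends to 1, to the
      right-hand side [D] of the radius equation.
    - Removing one factor fewer from [Re (T F) > 0] gives [Re F' > 0], that is
      [|g'| < Re h'] ([class_jacobian]).

    The last two facts show that [f] covers the disk [|v| < D]: a point of
    [|z| <= t] where [|f z - v|] is minimal must solve [f z = v], since
    otherwise moving [z] against the error decreases it, and on [|z| = t] this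
    move goes inwards ([covering]). Hence the boundary of the image is at
    distance at least [D] from [f 0 = 0], whereas the left-hand side of the
    inequality is, by the coefficient bounds, at most the left-hand side of the
    radius equation, which is [D] at the root.

    The extremal function has all its coefficients equal to the bounds in
    modulus. It tends to [D] along the positive axis and omits the value [D],
    because its derivative has positive real part ([extremal_omits]); so its
    image has a boundary point at distance [D], and the strict monotonicity of
    the left-hand side of the radius equation makes the inequality fail beyond
    the root. The same monotonicity gives uniqueness of the root, and the
    intermediate value theorem its existence.

    The inequalities of Caratheodory and Harnack both follow from one
    positivity statement about coefficientwise products of polynomials
    ([poly_convolution_ge0]), in which integrals over the circle are replaced
    by averages over roots of unity. *)

(** * Modulus and real part *)

Section modulus.
Variable R : realType.
Implicit Types z w : R[i].

Lemma ReD z w : complex.Re (z + w) = complex.Re z + complex.Re w.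
Proof. by case: z; case: w. Qed.

Lemma ReN z : complex.Re (- z) = - complex.Re z.
Proof. by case: z. Qed.

Lemma ReB z w : complex.Re (z - w) = complex.Re z - complex.Re w.
Proof. by rewrite ReD ReN. Qed.

Lemma ImB z w : complex.Im (z - w) = complex.Im z - complex.Im w.
Proof. by case: z; case: w. Qed.

Lemma Re_sum (I : Type) (r : seq I) (P : pred I) (F : I -> R[i]) :
  complex.Re (\sum_(i <- r | P i) F i) = \sum_(i <- r | P i) complex.Re (F i).
Proof. exact: (raddf_sum (@complex.Re R)). Qed.

Lemma Im_sum (I : Type) (r : seq I) (P : pred I) (F : I -> R[i]) :
  complex.Im (\sum_(i <- r | P i) F i) = \sum_(i <- r | P i) complex.Im (F i).
Proof. exact: (raddf_sum (@complex.Im R)). Qed.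

Lemma normcE z : `|z| = (normc z)%:C. Proof. by case: z. Qed.

Lemma normc_ge0 z : 0 <= normc z.
Proof. by case: z => x y; rewrite /= sqrtr_ge0. Qed.

Lemma normc_sqr z : normc z ^+ 2 = complex.Re z ^+ 2 + complex.Im z ^+ 2.
Proof. by case: z => x y; rewrite /= sqr_sqrtr // addr_ge0 ?sqr_ge0. Qed.

Lemma normc_real (x : R) : normc x%:C = `|x|.
Proof. by rewrite /= expr0n addr0 sqrtr_sqr. Qed.

Lemma normcX z n : normc (z ^+ n) = normc z ^+ n.
Proof. by elim: n => [|n IH]; rewrite ?expr0 ?normc1 // !exprS normcM IH. Qed.

Lemma normc_conj z : normc (conjc z) = normc z.
Proof. by case: z => x y; rewrite /= sqrrN. Qed.

Lemma normcB z w : normc (z - w) = normc (w - z).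
Proof. by rewrite -normcN opprB. Qed.

Lemma normcD_le z w : normc (z + w) <= normc z + normc w.
Proof. exact: le_normcD. Qed.

Lemma normcB_ge z w : normc z - normc w <= normc (z - w).
Proof. by rewrite lerBlDr -{1}(subrK w z) normcD_le. Qed.

Lemma normc_sum (I : Type) (r : seq I) (P : pred I) (F : I -> R[i]) :
  normc (\sum_(i <- r | P i) F i) <= \sum_(i <- r | P i) normc (F i).
Proof.
elim/big_ind2: _ => // [|x1 x2 y1 y2 h1 h2]; first by rewrite normc0.
by rewrite (le_trans (normcD_le _ _)) // lerD.
Qed.

Lemma normRe_le z : `|complex.Re z| <= normc z.
Proof.
rewrite -(@ler_pXn2r _ 2) ?nnegrE ?normc_ge0 // normc_sqr real_normK ?num_real //.
by rewrite lerDl sqr_ge0.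
Qed.

Lemma Re_le_normc z : complex.Re z <= normc z.
Proof. exact: le_trans (ler_norm _) (normRe_le z). Qed.

Lemma ReN_le_normc z : - normc z <= complex.Re z.
Proof. by rewrite lerNl -ReN (le_trans (Re_le_normc _)) // normcN. Qed.

Lemma normIm_le z : `|complex.Im z| <= normc z.
Proof.
rewrite -(@ler_pXn2r _ 2) ?nnegrE ?normc_ge0 // normc_sqr real_normK ?num_real //.
by rewrite lerDr sqr_ge0.
Qed.

Lemma normc_le_Re_Im z : normc z <= `|complex.Re z| + `|complex.Im z|.
Proof.
rewrite -(@ler_pXn2r _ 2) ?nnegrE ?normc_ge0 ?addr_ge0 // normc_sqr.
rewrite sqrrD !real_normK ?num_real //.
have := mulr_ge0 (normr_ge0 (complex.Re z)) (normr_ge0 (complex.Im z)); lra.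
Qed.

Lemma mulc_conj z : z * conjc z = (normc z ^+ 2)%:C.
Proof. by case: z => x y; rewrite normc_sqr; simpc => /=; congr Complex; ring. Qed.

Lemma conjc_mul z : conjc z * z = (normc z ^+ 2)%:C.
Proof. by rewrite mulrC mulc_conj. Qed.

Lemma Re_mulrc (x : R) z : complex.Re (x%:C * z) = x * complex.Re z.
Proof. by case: z => a b /=; rewrite mul0r subr0. Qed.

Lemma Re_conj z : complex.Re (conjc z) = complex.Re z.
Proof. by case: z. Qed.

Lemma realcX (x : R) n : (x ^+ n)%:C = x%:C ^+ n.
Proof. exact: rmorphXn. Qed.

Lemma normc_nat n : normc (n%:R : R[i]) = n%:R.
Proof. by rewrite -(rmorph_nat (real_complex R)) normc_real ger0_norm. Qed.

Lemma natC n : (n%:R : R[i]) = (n%:R)%:C.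
Proof. by rewrite rmorph_nat. Qed.

Lemma conjcM z w : conjc (z * w) = conjc z * conjc w.
Proof. exact: rmorphM. Qed.

Lemma conjcN z : conjc (- z) = - conjc z.
Proof. exact: rmorphN. Qed.

Lemma conjcB z w : conjc (z - w) = conjc z - conjc w.
Proof. exact: rmorphB. Qed.

Lemma phaseP z : exists2 u, normc u = 1 & u * z = (normc z)%:C.
Proof.
have [->|z0] := eqVneq z 0; first by exists 1; rewrite ?normc1 // mulr0 normc0.
have nz0 : normc z != 0 by apply: contra z0 => /eqP /eq0_normc ->.
exists (conjc z / (normc z)%:C).
  by rewrite normcM normcV normc_conj normc_real ger0_norm ?normc_ge0 // divff.
by rewrite mulrAC conjc_mul expr2 [X in X / _]rmorphM /= mulfK // (inj_eq (@complexI R)).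
Qed.

Lemma polarP z : exists2 u, normc u = 1 & z = (normc z)%:C * u.
Proof.
have [u u1 uz] := phaseP z; exists (conjc u); first by rewrite normc_conj.
by rewrite -uz mulrAC mulc_conj u1 expr1n mul1r.
Qed.

End modulus.

(** * Series of complex numbers *)

Section series.
Variable R : realType.
Implicit Types u v : nat -> R[i].

Definition has_sum u (l : R[i]) : Prop :=
  (fun n => normc (l - \sum_(k < n) u k)) @ \oo --> (0 : R).

Definition abs_summable u : Prop :=
  exists B : R, forall n, \sum_(k < n) normc (u k) <= B.

(** The value is 0 when the series has no sum. *)
Definition csum u : R[i] := xget 0 [set l | has_sum u l].

Lemma bounded_cvg_series (x : nat -> R) (B : R) :
  (forall n, \sum_(k < n) `|x k| <= B) -> cvgn (series x).
Proof.
move=> xB; apply: normed_cvg.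
suff: cvgn (series (fun k => `|x k|)) by [].
apply: nondecreasing_is_cvgn.
  by apply/nondecreasing_seqP => n; rewrite seriesSr lerDl.
by exists B => _ [n _ <-]; rewrite /series /= big_mkord.
Qed.

Lemma has_sumP u l : has_sum u l <->
  forall e : R, 0 < e -> \forall n \near \oo, normc (l - \sum_(k < n) u k) < e.
Proof.
split=> [/cvgrPdist_lt h e e0|h].
  by near=> n; near: n; apply: filterS (h e e0) => n; rewrite sub0r normrN ger0_norm // normc_ge0.
apply/cvgrPdist_lt => e e0; near=> n; rewrite sub0r normrN ger0_norm ?normc_ge0 //.
by near: n; exact: h.
Unshelve. all: by end_near. Qed.

Lemma has_sum_csum u : abs_summable u -> has_sum u (csum u).
Proof.
move=> [B uB]; suff [l hl] : exists l, has_sum u l.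
  by apply: (@xgetPex _ 0 [set l' | has_sum u l']); exists l.
exists (limn (series (fun k => complex.Re (u k))) +i*
        limn (series (fun k => complex.Im (u k)))).
have cR : cvgn (series (fun k => complex.Re (u k))).
  apply: (@bounded_cvg_series _ B) => n; apply: le_trans (uB n).
  by apply: ler_sum => i _; exact: normRe_le.
have cI : cvgn (series (fun k => complex.Im (u k))).
  apply: (@bounded_cvg_series _ B) => n; apply: le_trans (uB n).
  by apply: ler_sum => i _; exact: normIm_le.
apply/has_sumP => e e0; have e20 : 0 < e / 2 by rewrite divr_gt0.
have hR := iffLR (cvgrPdist_lt _ _) cR _ e20.
have hI := iffLR (cvgrPdist_lt _ _) cI _ e20.
near=> n; apply: (le_lt_trans (normc_le_Re_Im _)).
rewrite ReB ImB Re_sum Im_sum (splitr e) ltrD //.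
  rewrite -(big_mkord xpredT (fun i => complex.Re (u i))).
  by near: n; exact: hR.
rewrite -(big_mkord xpredT (fun i => complex.Im (u i))).
by near: n; exact: hI.
Unshelve. all: by end_near. Qed.

Lemma has_sum_unique u l l' : has_sum u l -> has_sum u l' -> l = l'.
Proof.
move=> /has_sumP h /has_sumP h'; apply/eqP; rewrite -subr_eq0.
apply: contraT => ll'.
have e0 : 0 < normc (l - l') / 2.
  rewrite divr_gt0 // lt_neqAle normc_ge0 andbT eq_sym.
  by apply: contra ll' => /eqP /eq0_normc ->.
have [n hn] : exists n, normc (l - \sum_(k < n) u k) < normc (l - l') / 2 /\
   normc (l' - \sum_(k < n) u k) < normc (l - l') / 2.
  near \oo => n; exists n; split; near: n; [exact: h|exact: h'].
have := normcD_le (l - \sum_(k < n) u k) (\sum_(k < n) u k - l').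
rewrite addrA subrK [normc (\sum_(k < n) u k - l')]normcB => hh.
case: hn => h1 h2; lra.
Unshelve. all: by end_near. Qed.

Lemma csumE u l : abs_summable u -> has_sum u l -> csum u = l.
Proof. by move=> /has_sum_csum; exact: has_sum_unique. Qed.

Lemma has_sum_ext u v l : u =1 v -> has_sum u l -> has_sum v l.
Proof. by move=> /funext ->. Qed.

Lemma has_sumD u v l l' :
  has_sum u l -> has_sum v l' -> has_sum (fun k => u k + v k) (l + l').
Proof.
move=> /has_sumP h /has_sumP h'; apply/has_sumP => e e0; near=> n.
rewrite big_split /= opprD addrACA (le_lt_trans (normcD_le _ _)) //.
rewrite (splitr e) ltrD //; near: n; [apply: h|apply: h']; rewrite divr_gt0 //.
Unshelve. all: by end_near. Qed.

Lemma has_sumZ u c l : has_sum u l -> has_sum (fun k => c * u k) (c * l).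
Proof.
move=> h; rewrite /has_sum.
rewrite (_ : (fun n => _) = (fun n => normc c * normc (l - \sum_(k < n) u k))).
  by rewrite -(mulr0 (normc c)); apply: cvgMl_tmp; exact: h.
by apply/funext => n; rewrite -mulr_sumr -mulrBr normcM.
Qed.

Lemma has_sumB u v l l' :
  has_sum u l -> has_sum v l' -> has_sum (fun k => u k - v k) (l - l').
Proof.
move=> h /(has_sumZ (-1)); rewrite mulN1r => h'.
by apply: has_sum_ext (has_sumD h h') => k; rewrite mulN1r.
Qed.

Lemma has_sum_cons u l : has_sum (fun k => u k.+1) l -> has_sum u (u 0%N + l).
Proof.
move=> h; rewrite /has_sum -(cvg_shiftS (fun n : nat => _)) /=.
rewrite (_ : (fun n => _) = (fun n => normc (l - \sum_(k < n) u k.+1))) //.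
by apply/funext => n; rewrite big_ord_recl /= opprD addrACA subrr add0r.
Qed.

(** The partial sums are bounded instead of the sum of the moduli, so that no
    second limit is involved. *)
Lemma has_sum_norm_le u l (B : R) :
  has_sum u l -> (forall n, \sum_(k < n) normc (u k) <= B) -> normc l <= B.
Proof.
move=> /has_sumP h uB; apply/ler_addgt0Pr => e e0.
near \oo => n; have : normc (l - \sum_(k < n) u k) < e by near: n; exact: h.
have := normcB_ge l (\sum_(k < n) u k).
have := normc_sum (index_enum 'I_n) xpredT (fun k => u k).
have := uB n; lra.
Unshelve. all: by end_near. Qed.

Lemma has_sum_Re u l :
  has_sum u l -> series (fun k => complex.Re (u k)) @ \oo --> complex.Re l.
Proof.
move=> /has_sumP h; apply/cvgrPdist_lt => e e0; near=> n.
rewrite /series /= big_mkord -Re_sum -ReB.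
by apply: le_lt_trans (normRe_le _) _; near: n; exact: h.
Unshelve. all: by end_near. Qed.

Lemma has_sum_tail u l n : has_sum u l ->
  has_sum (fun k => u (n + k)%N) (l - \sum_(k < n) u k).
Proof.
move=> h; rewrite /has_sum.
have := h; rewrite /has_sum -(cvg_shiftn n (fun n : nat => _)) /=.
rewrite (_ : (fun n0 => _) = (fun n0 => normc (l - \sum_(k < n) u k - \sum_(k < n0) u (n + k)%N))) //.
by apply/funext => m; rewrite addnC big_split_ord /= opprD addrA.
Qed.

End series.

(** * Power series on the unit disk *)

Section power_series.
Variable R : realType.
Implicit Types (a b : nat -> R[i]) (z w k : R[i]).

(** Radius of convergence at least 1, in the form of Cauchy's estimates: unlike
    summability, this is visibly stable under the coefficientwise operations. *)
Definition disk_coefs a : Prop := forall r : R, 0 <= r < 1 ->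
  exists B : R, forall m, normc (a m) * r ^+ m <= B.

Definition PS a z : R[i] := csum (fun m => a m * z ^+ m).

Definition dcoef a : nat -> R[i] := fun m => m.+1%:R * a m.+1.

Lemma geometric_sum_le (q : R) n : 0 <= q < 1 -> \sum_(k < n) q ^+ k <= (1 - q)^-1.
Proof.
move=> /andP[q0 q1]; have q1' : 0 < 1 - q by rewrite subr_gt0.
rewrite -[leRHS]mul1r ler_pdivlMr //.
have -> : (\sum_(k < n) q ^+ k) * (1 - q) = 1 - q ^+ n.
  by have := subrX1 q n; rewrite -[1 - q]opprB -[1 - q ^+ n]opprB => ->; rewrite mulrN mulrC.
by rewrite gerBl exprn_ge0.
Qed.

Lemma natmul_geometric_le (q : R) m : 0 <= q < 1 -> m%:R * q ^+ m <= (1 - q)^-1.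
Proof.
move=> q01; apply: le_trans (geometric_sum_le m q01); move: q01 => /andP[q0 q1].
rewrite mulr_natl -[X in _ *+ X]card_ord -sumr_const; apply: ler_sum => i _.
exact: (ler_wiXn2l q0 (ltW q1) (ltnW (ltn_ord i))).
Qed.

(** Comparison with a geometric series through an intermediate radius. *)
Lemma disk_coefs_sum a (r : R) : disk_coefs a -> 0 <= r < 1 ->
  exists B : R, forall n, \sum_(m < n) normc (a m) * r ^+ m <= B.
Proof.
move=> da /andP[r0 r1]; pose s := (1 + r) / 2.
have s0 : 0 < s by rewrite /s; lra.
have s1 : s < 1 by rewrite /s; lra.
have rs : r < s by rewrite /s; lra.
have [|B hB] := da s; first by rewrite ltW.
have q01 : 0 <= r / s < 1 by rewrite divr_ge0 ?(ltW s0) // ltr_pdivrMr // mul1r.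
have B0 : 0 <= B.
  by apply: le_trans (hB 0%N); rewrite expr0 mulr1 normc_ge0.
exists (B * (1 - r / s)^-1) => n.
apply: (@le_trans _ _ (B * \sum_(m < n) (r / s) ^+ m)).
  rewrite mulr_sumr; apply: ler_sum => i _.
  rewrite (_ : r ^+ i = s ^+ i * (r / s) ^+ i).
    by rewrite mulrA ler_wpM2r // exprn_ge0 // (andP q01).1.
  by rewrite -exprMn mulrCA divff ?mulr1 // gt_eqF.
by rewrite ler_wpM2l // geometric_sum_le.
Qed.

Lemma disk_coefs_summable a z : disk_coefs a -> normc z < 1 ->
  abs_summable (fun m => a m * z ^+ m).
Proof.
move=> da z1; have [|B hB] := disk_coefs_sum da (r := normc z).
  by rewrite normc_ge0.
exists B => n; apply: le_trans (hB n); apply: ler_sum => i _.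
by rewrite normcM normcX.
Qed.

Lemma has_sum_PS a z : disk_coefs a -> normc z < 1 ->
  has_sum (fun m => a m * z ^+ m) (PS a z).
Proof. by move=> da z1; apply/has_sum_csum/disk_coefs_summable. Qed.

Lemma PSE a z l : disk_coefs a -> normc z < 1 ->
  has_sum (fun m => a m * z ^+ m) l -> PS a z = l.
Proof. by move=> da z1; apply/csumE/disk_coefs_summable. Qed.

Lemma disk_coefs_le a b (K : R) : disk_coefs a ->
  (forall m, normc (b m) <= K * normc (a m)) -> disk_coefs b.
Proof.
move=> da ba r r01; have [B hB] := da r r01; exists (`|K| * B) => m.
apply: (@le_trans _ _ (`|K| * (normc (a m) * r ^+ m))).
  rewrite mulrA ler_wpM2r ?exprn_ge0 ?(andP r01).1 //.
  by apply: le_trans (ba m) _; rewrite ler_wpM2r ?normc_ge0 // ler_norm.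
by rewrite ler_wpM2l.
Qed.

Lemma disk_coefs_bounded a (K : R) : (forall m, normc (a m) <= K) -> disk_coefs a.
Proof.
move=> aK r /andP[r0 r1]; exists K => m; apply: le_trans (aK m).
by rewrite ler_piMr ?normc_ge0 // exprn_ile1 // ltW.
Qed.

Lemma disk_coefsD a b : disk_coefs a -> disk_coefs b ->
  disk_coefs (fun m => a m + b m).
Proof.
move=> da db r r01; have [A hA] := da r r01; have [B hB] := db r r01.
exists (A + B) => m; apply: le_trans (lerD (hA m) (hB m)).
by rewrite -mulrDl ler_wpM2r ?normcD_le // exprn_ge0 ?(andP r01).1.
Qed.

Lemma disk_coefsZ a w : disk_coefs a -> disk_coefs (fun m => w * a m).
Proof. by move=> da; apply: (disk_coefs_le (K := normc w) da) => m; rewrite normcM. Qed.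

(** The factor [m] is absorbed by passing to a larger radius. *)
Lemma disk_coefsMn a : disk_coefs a -> disk_coefs (fun m => m%:R * a m).
Proof.
move=> da r /andP[r0 r1]; pose s := (1 + r) / 2.
have s0 : 0 < s by rewrite /s; lra.
have s1 : s < 1 by rewrite /s; lra.
have rs : r < s by rewrite /s; lra.
have [|B hB] := da s; first by rewrite ltW.
have q01 : 0 <= r / s < 1 by rewrite divr_ge0 ?(ltW s0) // ltr_pdivrMr // mul1r.
exists ((1 - r / s)^-1 * B) => m; rewrite normcM normc_nat.
have -> : m%:R * normc (a m) * r ^+ m =
    (m%:R * (r / s) ^+ m) * (normc (a m) * s ^+ m).
  by rewrite expr_div_n; field; rewrite expf_neq0 // gt_eqF.
have [q0 q1] := andP q01; apply: ler_pM => //.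
- by rewrite mulr_ge0 ?exprn_ge0.
- by rewrite mulr_ge0 ?normc_ge0 ?exprn_ge0 ?(ltW s0).
- exact: natmul_geometric_le.
Qed.

Lemma disk_coefs_shift a : disk_coefs a -> disk_coefs (fun m => a m.+1).
Proof.
move=> da r /andP[r0 r1]; pose s := (1 + r) / 2.
have s0 : 0 < s by rewrite /s; lra.
have s1 : s < 1 by rewrite /s; lra.
have rs : r < s by rewrite /s; lra.
have [|B hB] := da s; first by rewrite ltW.
exists (s^-1 * B) => m; rewrite ler_pdivlMl // mulrCA.
apply: le_trans (hB m.+1); rewrite exprS ler_wpM2l ?normc_ge0 //.
by rewrite ler_wpM2l ?(ltW s0) // lerXn2r ?nnegrE ?(ltW s0) // (ltW rs).
Qed.

Lemma disk_coefs_dcoef a : disk_coefs a -> disk_coefs (dcoef a).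
Proof. by move=> /disk_coefsMn /disk_coefs_shift. Qed.

Lemma PS_cons a z : disk_coefs a -> normc z < 1 ->
  PS a z = a 0%N + z * PS (fun m => a m.+1) z.
Proof.
move=> da z1; apply: PSE => //; rewrite -[a 0%N]mulr1 -(expr0 z).
apply: (@has_sum_cons _ (fun m => a m * z ^+ m)).
apply: has_sum_ext (has_sumZ z (has_sum_PS (disk_coefs_shift da) z1)) => m.
by rewrite exprS mulrCA.
Qed.

(** Multiplying through by [rho ^+ 2] avoids the exponent [m - 2] of the usual
    bound, which is meaningless for small [m]. *)
Lemma exprD_taylor_le z k (rho : R) m :
  0 < rho -> normc z <= rho -> normc (z + k) <= rho ->
  rho ^+ 2 * normc ((z + k) ^+ m - z ^+ m - k * (m%:R * z ^+ m.-1))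
    <= normc k ^+ 2 * (m%:R ^+ 2 * rho ^+ m).
Proof.
move=> rho0 zr zkr; elim: m => [|m IH].
  by rewrite !expr0 subrr mul0r mulr0 subr0 normc0 mulr0 expr0n mul0r mulr0.
pose e := (z + k) ^+ m - z ^+ m - k * (m%:R * z ^+ m.-1).
have -> : (z + k) ^+ m.+1 - z ^+ m.+1 - k * (m.+1%:R * z ^+ m.+1.-1) =
    (z + k) * e + k ^+ 2 * (m%:R * z ^+ m.-1).
  rewrite /e; case: m {IH e} => [|m]; first by rewrite !expr0 !expr1 /=; ring.
  by rewrite /= !exprS -natr1; ring.
have h1 : rho ^+ 2 * normc ((z + k) * e) <=
    rho * (normc k ^+ 2 * (m%:R ^+ 2 * rho ^+ m)).
  by rewrite normcM mulrCA ler_pM ?mulr_ge0 ?exprn_ge0 ?normc_ge0 ?(ltW rho0).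
have h2 : rho ^+ 2 * normc (k ^+ 2 * (m%:R * z ^+ m.-1)) <=
    normc k ^+ 2 * (m%:R * rho ^+ m.+1).
  rewrite normcM normcX [normc (m%:R * _)]normcM normcX normc_nat mulrCA.
  rewrite ler_wpM2l ?exprn_ge0 ?normc_ge0 //.
  case: m {IH h1 e} => [|m] /=; first by rewrite !mul0r mulr0.
  rewrite mulrCA ler_wpM2l // -[m.+2]addn2 exprD [leRHS]mulrC.
  rewrite ler_wpM2l ?exprn_ge0 ?(ltW rho0) //.
  by rewrite lerXn2r ?nnegrE ?normc_ge0 ?(ltW rho0).
have h3 : rho ^+ 2 * normc ((z + k) * e + k ^+ 2 * (m%:R * z ^+ m.-1)) <=
    rho * (normc k ^+ 2 * (m%:R ^+ 2 * rho ^+ m)) +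
    normc k ^+ 2 * (m%:R * rho ^+ m.+1).
  apply: le_trans (lerD h1 h2); rewrite -mulrDr ler_wpM2l ?normcD_le //.
  by rewrite exprn_ge0 ?(ltW rho0).
apply: le_trans h3 _; rewrite mulrCA -mulrDr ler_wpM2l ?exprn_ge0 ?normc_ge0 //.
rewrite mulrCA -exprS -mulrDl ler_wpM2r ?exprn_ge0 ?(ltW rho0) //.
by rewrite -natr1 sqrrD mulr1 expr1n mulr2n; have := ler0n R m; lra.
Qed.

(** All that is used of differentiability: the error of the linear
    approximation is quadratic, with a constant independent of [k]. It yields
    complex derivatives, derivatives along real lines and local Lipschitz
    bounds alike. *)
Lemma PS_taylor a z : disk_coefs a -> normc z < 1 ->
  exists C eta : R, [/\ 0 <= C, 0 < eta, normc z + eta < 1 &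
    forall k, normc k < eta ->
      normc (PS a (z + k) - PS a z - k * PS (dcoef a) z) <= C * normc k ^+ 2].
Proof.
move=> da z1; pose rho := (1 + normc z) / 2; pose eta := (1 - normc z) / 2.
have nz0 := normc_ge0 z.
have rho0 : 0 < rho by rewrite /rho; lra.
have rho1 : rho < 1 by rewrite /rho; lra.
have [|B hB] := disk_coefs_sum (disk_coefsMn (disk_coefsMn da)) (r := rho).
  by rewrite (ltW rho0).
have B0 : 0 <= B by have := hB 0%N; rewrite big_ord0.
exists (B / rho ^+ 2), eta; split; rewrite ?divr_ge0 ?exprn_ge0 ?(ltW rho0) //.
- by rewrite /eta; lra.
- by rewrite /eta; lra.
move=> k keta.
have zkr : normc (z + k) < rho.
  by apply: le_lt_trans (normcD_le _ _) _; move: keta; rewrite /rho /eta; lra.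
have zr : normc z <= rho by rewrite /rho; lra.
have hd : has_sum (fun m => m%:R * a m * z ^+ m.-1) (PS (dcoef a) z).
  rewrite -[PS _ _]add0r -[X in X + _](mul0r (a 0%N)).
  rewrite -[X in X + _]mulr1 -(expr0 z).
  apply: (@has_sum_cons _ (fun m => m%:R * a m * z ^+ m.-1)).
  exact: (has_sum_PS (disk_coefs_dcoef da) z1).
have hs := has_sumB (has_sumB (has_sum_PS da (lt_trans zkr rho1))
  (has_sum_PS da z1)) (has_sumZ k hd).
apply: has_sum_norm_le hs _ => n.
apply: (@le_trans _ _ (\sum_(m < n) normc k ^+ 2 / rho ^+ 2 *
    (normc (m%:R * (m%:R * a m)) * rho ^+ m))).
  apply: ler_sum => m _.
  have := exprD_taylor_le m rho0 zr (ltW zkr).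
  have -> : a m * (z + k) ^+ m - a m * z ^+ m - k * (m%:R * a m * z ^+ m.-1) =
    a m * ((z + k) ^+ m - z ^+ m - k * (m%:R * z ^+ m.-1)) by ring.
  rewrite -ler_pdivlMl ?exprn_gt0 // normcM => h.
  apply: le_trans (ler_wpM2l (normc_ge0 _) h) _.
  by rewrite !normcM normc_nat le_eqVlt; apply/orP; left; apply/eqP; ring.
have -> : B / rho ^+ 2 * normc k ^+ 2 = normc k ^+ 2 / rho ^+ 2 * B by ring.
by rewrite -mulr_sumr ler_wpM2l ?hB // divr_ge0 ?exprn_ge0 ?normc_ge0 ?(ltW rho0).
Qed.

End power_series.

(** * Differentiation of power series *)

(** Stated over a [numFieldType] because it serves both for complex derivatives
    and for derivatives in a real parameter. *)
Lemma is_derive_taylor (K : numFieldType) (f : K^o -> K^o) (z d C eta : K) :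
  0 <= C -> 0 < eta ->
  (forall k, `|k| < eta -> `|f (z + k) - f z - k * d| <= C * `|k| ^+ 2) ->
  is_derive (z : K^o) (1 : K^o) f d.
Proof.
move=> C0 eta0 hf.
have h : (fun h : K => h^-1 *: ((f \o shift z) (h *: (1 : K^o)) - f z)) @ 0^' --> (d : K^o).
  apply/cvgrPdist_lt => e e0; near=> k.
  have k0 : k != 0 by near: k; exact: nbhs_dnbhs_neq.
  have ke : `|k| < eta by near: k; apply: dnbhs0_lt.
  have kC : `|k| < e / (C + 1) by near: k; apply: dnbhs0_lt; rewrite divr_gt0 // ltr_wpDl.
  have -> : d - k^-1 *: ((f \o shift z) (k *: (1 : K^o)) - f z) =
     - (k^-1 * (f (z + k) - f z - k * d)).
    change (d - k^-1 * (f (k * 1 + z) - f z) = - (k^-1 * (f (z + k) - f z - k * d))).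
    rewrite mulr1 [k + z]addrC [in RHS]mulrBr mulKf //.
    by rewrite opprB.
  rewrite normrN normrM normfV ltr_pdivrMl ?normr_gt0 //.
  apply: le_lt_trans (hf k ke) _; rewrite expr2 mulrCA ltr_pM2l ?normr_gt0 //.
  rewrite ltr_pdivlMr ?ltr_wpDl // in kC; apply: le_lt_trans kC.
  by rewrite mulrC ler_wpM2l // lerDl.
by split; [apply/cvg_ex; exists d; exact: h | exact/cvg_lim].
Unshelve. all: by end_near. Qed.

Section power_series_derivatives.
Variable R : realType.
Implicit Types (a b : nat -> R[i]) (z w k : R[i]).

Lemma PS_derive1 (h : R[i]^o -> R[i]^o) a : disk_coefs a ->
  (forall z, normc z < 1 -> h z = PS a z) ->
  forall z, normc z < 1 ->
    derivable h (z : R[i]^o) 1 /\ h^`()%classic z = PS (dcoef a) z.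
Proof.
move=> da ha z z1; have [C [eta [C0 eta0 etaz hC]]] := PS_taylor da z1.
have H : is_derive (z : R[i]^o) (1 : R[i]^o) h (PS (dcoef a) z).
  apply: (@is_derive_taylor _ _ _ _ C%:C eta%:C); rewrite ?ler0c ?ltcR //.
  move=> k; rewrite !normcE ltcR => ke.
  rewrite -realcX -rmorphM lecR !ha //; first exact: hC.
  by apply: le_lt_trans (normcD_le _ _) _; apply: lt_trans etaz; rewrite ltrD2l.
by split; [exact: ex_derive | rewrite derive1E; exact: derive_val].
Qed.

Lemma PS_line_derive a z w k (t : R) : disk_coefs a -> normc (z + t%:C * k) < 1 ->
  is_derive (t : R^o) (1 : R^o) (fun s : R => complex.Re (w * PS a (z + s%:C * k)) : R^o)
    (complex.Re (w * (k * PS (dcoef a) (z + t%:C * k)))).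
Proof.
move=> da z1; have [C [eta [C0 eta0 etaz hC]]] := PS_taylor da z1.
have k1 : 0 < normc k + 1 by rewrite ltr_wpDl ?normc_ge0.
apply: (@is_derive_taylor _ _ _ _ (normc w * C * normc k ^+ 2) (eta / (normc k + 1))).
- by rewrite !mulr_ge0 ?exprn_ge0 ?normc_ge0.
- by rewrite divr_gt0.
move=> s; rewrite ltr_pdivlMr // => hs.
have ks : normc (s%:C * k) < eta.
  apply: le_lt_trans hs; rewrite normcM normc_real ler_wpM2l //.
  by rewrite lerDl.
have := hC _ ks.
have -> : z + t%:C * k + s%:C * k = z + (t + s)%:C * k.
  by rewrite rmorphD /= mulrDl addrA.
move=> h.
rewrite -Re_mulrc -!ReB.
apply: le_trans (normRe_le _) _.
rewrite -mulrBr [s%:C * _]mulrCA -mulrBr mulrA.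
rewrite normcM -!mulrA ler_wpM2l ?normc_ge0 //.
rewrite mulrA; apply: le_trans h _; rewrite normcM normc_real exprMn.
by rewrite expr2 [`|s| ^+ 2 * _]mulrC -mulrA -!expr2 mulrA -expr2.
Qed.

End power_series_derivatives.

(** * Linear operations on power series and the third-order operator *)

Section operator.
Variable R : realType.
Implicit Types (a b : nat -> R[i]) (z w : R[i]).

Lemma eq_disk_coefs a b : a =1 b -> disk_coefs a -> disk_coefs b.
Proof. by move=> /funext ->. Qed.

Lemma PSD a b z : disk_coefs a -> disk_coefs b -> normc z < 1 ->
  PS (fun m => a m + b m) z = PS a z + PS b z.
Proof.
move=> da db z1; apply: PSE => //; first exact: disk_coefsD.
by apply: has_sum_ext (has_sumD (has_sum_PS da z1) (has_sum_PS db z1)) => m; rewrite mulrDl.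
Qed.

Lemma PSZ a w z : disk_coefs a -> normc z < 1 ->
  PS (fun m => w * a m) z = w * PS a z.
Proof.
move=> da z1; apply: PSE => //; first exact: disk_coefsZ.
by apply: has_sum_ext (has_sumZ w (has_sum_PS da z1)) => m; rewrite mulrA.
Qed.

Lemma eq_PS a b z : a =1 b -> PS a z = PS b z.
Proof. by move=> /funext ->. Qed.

Lemma disk_coefsB a b : disk_coefs a -> disk_coefs b ->
  disk_coefs (fun m => a m - b m).
Proof.
move=> da db; apply: eq_disk_coefs (disk_coefsD da (disk_coefsZ (-1) db)) => m.
by rewrite mulN1r.
Qed.

Lemma PSB a b z : disk_coefs a -> disk_coefs b -> normc z < 1 ->
  PS (fun m => a m - b m) z = PS a z - PS b z.
Proof.
move=> da db z1; apply: PSE => //; first exact: disk_coefsB.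
by apply: has_sum_ext (has_sumB (has_sum_PS da z1) (has_sum_PS db z1)) => m; rewrite mulrBl.
Qed.

Lemma disk_coefs_const (e : R[i]) : disk_coefs (fun m => if m == 0%N then e else 0).
Proof.
apply: (disk_coefs_bounded (K := normc e)) => -[|m]; first exact: lexx.
by change (normc (0 : R[i]) <= normc e); rewrite normc0 normc_ge0.
Qed.

Lemma PS_const (e : R[i]) z : normc z < 1 ->
  PS (fun m => if m == 0%N then e else 0) z = e.
Proof.
move=> z1; rewrite PS_cons //=; last exact: disk_coefs_const.
rewrite (_ : PS _ z = 0) ?mulr0 ?addr0 //; apply: PSE => //.
  by apply: (disk_coefs_bounded (K := 0)) => m; rewrite normc0.
apply/has_sumP => d d0; near=> n; rewrite big1 ?subrr ?normc0 // => i _.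
by rewrite mul0r.
Unshelve. all: by end_near. Qed.

Lemma disk_coefs_affine a (al ka : R) : disk_coefs a ->
  disk_coefs (fun m => (al + ka * m%:R)%:C * a m).
Proof.
move=> da; apply: eq_disk_coefs (disk_coefsD (disk_coefsZ al%:C da)
  (disk_coefsZ ka%:C (disk_coefsMn da))) => m.
by rewrite mulrA -mulrDl natC -rmorphM -rmorphD.
Qed.

(** [theta = z d/dz] is diagonal on power series. *)
Lemma mulz_PS_dcoef a z : disk_coefs a -> normc z < 1 ->
  z * PS (dcoef a) z = PS (fun m => m%:R * a m) z.
Proof.
move=> da z1; rewrite [RHS]PS_cons ?mul0r ?add0r //; exact: disk_coefsMn.
Qed.

Lemma PS_weight a (al ka : R) z : disk_coefs a -> normc z < 1 ->
  PS (fun m => (al + ka * m%:R)%:C * a m) z =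
  al%:C * PS a z + ka%:C * (z * PS (dcoef a) z).
Proof.
move=> da z1; have dm := disk_coefsMn da.
rewrite (mulz_PS_dcoef da z1) -(PSZ al%:C da z1) -(PSZ ka%:C dm z1).
rewrite -(PSD (disk_coefsZ _ da) (disk_coefsZ _ dm) z1).
by apply: eq_PS => m; rewrite mulrA -mulrDl natC -rmorphM -rmorphD.
Qed.

Lemma PS_rotate a z w : PS a (z * w) = PS (fun m => a m * w ^+ m) z.
Proof.
congr csum; apply/funext => m; rewrite exprMn; ring.
Qed.

Lemma disk_coefs_rotate a w : normc w = 1 -> disk_coefs a ->
  disk_coefs (fun m => a m * w ^+ m).
Proof.
move=> w1 da; apply: (disk_coefs_le (K := 1) da) => m.
by rewrite normcM normcX w1 expr1n mulr1 mul1r.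
Qed.

Lemma normc_polar (t : R) w : 0 <= t -> normc w = 1 -> normc (t%:C * w) = t.
Proof. by move=> t0 w1; rewrite normcM w1 mulr1 normc_real ger0_norm. Qed.

Lemma disk_coefs_sign : disk_coefs (fun k => (-1) ^+ k : R[i]).
Proof.
by apply: (disk_coefs_bounded (K := 1)) => k; rewrite normcX normcN normc1 expr1n.
Qed.

(** Splitting off the first term turns the geometric series into an equation for
    its own sum. *)
Lemma PS_sign z : normc z < 1 -> PS (fun k => (-1) ^+ k) z = (1 + z)^-1.
Proof.
move=> z1; have z1' : 1 + z != 0.
  apply: contraTneq z1 => /eqP; rewrite addrC addr_eq0 => /eqP ->.
  by rewrite normcN normc1 ltxx.
have : PS (fun k => (-1) ^+ k) z = 1 - z * PS (fun k => (-1) ^+ k) z.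
  rewrite {1}PS_cons ?expr0; [|exact: disk_coefs_sign|by []]; congr (_ + _).
  rewrite -mulrN; congr (_ * _).
  transitivity (-1 * PS (fun k => (-1) ^+ k) z); last by rewrite mulN1r.
  rewrite -(PSZ (-1) disk_coefs_sign z1).
  by apply: eq_PS => k; rewrite exprS.
move=> h; apply: (mulIf z1'); rewrite mulVf // mulrDr mulr1 {1}h [_ * z]mulrC.
by rewrite subrK.
Qed.

Lemma PS_derive1n (h : R[i]^o -> R[i]^o) a n : disk_coefs a ->
  (forall z, normc z < 1 -> h z = PS a z) ->
  forall z, normc z < 1 -> h^`(n)%classic z = PS (iter n (@dcoef R) a) z.
Proof.
move=> da ha; elim: n => [|n IH] z z1; first by rewrite derive1n0 ha.
rewrite derive1nS; apply: (PS_derive1 _ IH _).2 => //.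
by elim: n {IH} => [|n IH] //=; exact: disk_coefs_dcoef.
Qed.

(** The eigenvalue of the third-order operator on [z ^+ m.+1], up to the drop of
    the exponent by one. Its factored form, as opposed to the sum of the three
    terms of the operator, is what makes the operator invertible factor by
    factor. *)
Definition op_weight (gamma delta : R) (m : nat) : R :=
  m.+1%:R ^+ 2 * (gamma + (delta - gamma) / 2 * m%:R).

Lemma denomE (gamma delta : R) m : denom gamma delta m.+1 = 2 * op_weight gamma delta m.
Proof. by rewrite /denom /op_weight -natr1; field. Qed.

(** The weight is a cubic polynomial in [m.+1], here written without its
    factorisation. *)
Lemma disk_coefs_weight (gamma delta : R) a : disk_coefs a ->
  disk_coefs (fun m => (op_weight gamma delta m)%:C * a m.+1).
Proof.
move=> da; set kap := (delta - gamma) / 2.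
have d1 := disk_coefsMn (disk_coefsMn da).
have d2 := disk_coefsMn (disk_coefsMn (disk_coefsMn da)).
have := disk_coefs_shift (disk_coefsD (disk_coefsZ (gamma - kap)%:C d1) (disk_coefsZ kap%:C d2)).
apply: eq_disk_coefs => m; rewrite /op_weight -/kap !mulrA -mulrDl; congr (_ * _).
rewrite -(rmorph_nat (real_complex R)) -!rmorphM -rmorphD /= -natr1; congr (_%:C); ring.
Qed.

Lemma third_order_op_PS (gamma delta : R) (h : R[i]^o -> R[i]^o) a z : disk_coefs a ->
  (forall z, normc z < 1 -> h z = PS a z) -> normc z < 1 ->
  third_order_op gamma delta h z =
    PS (fun m => (op_weight gamma delta m)%:C * a m.+1) z.
Proof.
move=> da ha z1; rewrite /third_order_op.
have -> : h^`()%classic z = h^`(1)%classic z by rewrite derive1n1.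
rewrite !(PS_derive1n _ da ha) //=.
set b := dcoef a; have db : disk_coefs b := disk_coefs_dcoef da.
rewrite -mulrA mulz_PS_dcoef // expr2 -!mulrA mulz_PS_dcoef; last 2 first.
- exact: disk_coefs_dcoef.
- by [].
pose c m := m.-1%:R * b m.
have dc : disk_coefs c.
  apply: (disk_coefs_le (K := 1) (disk_coefsMn db)) => m; rewrite mul1r !normcM !normc_nat.
  by rewrite ler_wpM2r ?mulr_ge0 ?normc_ge0 // ler_nat leq_pred.
rewrite (@eq_PS (fun m => m%:R * dcoef b m) (dcoef c)); last first.
  by move=> m; rewrite /dcoef /c /=; rewrite mulrCA.
rewrite mulz_PS_dcoef //; have dmb := disk_coefsMn db; have dmc := disk_coefsMn dc.
rewrite -!PSZ // -!PSD //; first last.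
- exact: disk_coefsZ.
- exact: disk_coefsZ.
- exact: disk_coefsZ.
- by apply: disk_coefsD; apply: disk_coefsZ.
apply: eq_PS => m; rewrite /c /b /dcoef /op_weight !mulrA -!mulrDl; congr (_ * _).
rewrite !natC -!rmorphM -!rmorphD -rmorphM; congr (_%:C).
case: m => [|m] /=; first by ring.
by rewrite -!natr1; field.
Qed.

(** The sequence underlying [power_coefs], whose first two terms are
    prescribed. *)
Definition full_coefs (c : R[i]) a : nat -> R[i] :=
  fun m => match m with 0 => 0 | 1 => c | _ => a m end.

Lemma sum_full_coefs c a z n : (2 <= n)%N ->
  \sum_(k < n) full_coefs c a k * z ^+ k = c * z + \sum_(2 <= m < n) a m * z ^+ m.
Proof.
case: n => [|[|n]] // _; rewrite !big_ord_recl /= mul0r add0r expr1; congr (_ + _).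
by rewrite !big_add1 /= big_mkord.
Qed.

Lemma cvgC_normc (u : nat -> R[i]^o) (l : R[i]^o) :
  u @ \oo --> l <-> (fun n => normc (l - u n)) @ \oo --> (0 : R).
Proof.
split=> [/cvgrPdist_lt h|/cvgrPdist_lt h]; apply/cvgrPdist_lt => e e0.
  have := h e%:C; rewrite ltcR => /(_ e0); apply: filterS => n.
  by rewrite normcE ltcR sub0r normrN ger0_norm ?normc_ge0.
have e0' : 0 < complex.Re e by move: e0; rewrite ltcE => /andP[].
have := h _ e0'; apply: filterS => n; rewrite sub0r normrN ger0_norm ?normc_ge0 // => hn.
rewrite normcE ltcE /= hn andbT eq_sym; move: e0; rewrite ltcE => /andP[/eqP -> _] //.
Qed.

(** The terms of the series at the real point [r] are differences of partial
    sums, which are bounded. *)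
Lemma has_sum_disk_coefs a (h : R[i] -> R[i]) :
  (forall z, normc z < 1 -> has_sum (fun m => a m * z ^+ m) (h z)) -> disk_coefs a.
Proof.
move=> ha r /andP[r0 r1]; have rr : normc r%:C = r by rewrite normc_real ger0_norm.
have := ha r%:C; rewrite rr => /(_ r1) hr.
have [M hM] : exists M, forall n, normc (h r%:C - \sum_(k < n) a k * r%:C ^+ k) <= M.
  have [M _ hM] := pinfty_ex_gt0 (cvg_seq_bounded (cvgP _ hr)).
  by exists M => n; apply: le_trans (ler_norm _) (hM n I).
exists (M + M) => m; rewrite -{1}rr -normcX -normcM.
have := normcD_le (h r%:C - \sum_(k < m) a k * r%:C ^+ k)
   (- (h r%:C - \sum_(k < m.+1) a k * r%:C ^+ k)).
rewrite [X in normc X <= _](_ : _ = a m * r%:C ^+ m); last first.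
  by rewrite big_ord_recr /= opprB 2!addrA subrK addrAC subrr add0r.
by move=> h1; apply: le_trans h1 _; rewrite normcN lerD.
Qed.

Lemma power_coefsP c a (h : R[i]^o -> R[i]^o) : power_coefs c a h <->
  forall z, normc z < 1 -> has_sum (fun m => full_coefs c a m * z ^+ m) (h z).
Proof.
suff H z : ((fun n : nat => c * z + \sum_(2 <= m < n) a m * z ^+ m : R[i]^o) @ \oo --> h z)
   <-> has_sum (fun m => full_coefs c a m * z ^+ m) (h z).
  by split=> ha z z1; apply/H; apply: ha.
rewrite cvgC_normc /has_sum -[X in X <-> _](cvg_shiftn 2) -[X in _ <-> X](cvg_shiftn 2).
rewrite (_ : [sequence _]_n = [sequence normc (h z -
   \sum_(k < n + 2) full_coefs c a k * z ^+ k)]_n) //.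
by apply/funext => n /=; rewrite sum_full_coefs // addn2.
Qed.

Lemma power_coefs_PS c a (h : R[i]^o -> R[i]^o) : power_coefs c a h ->
  disk_coefs (full_coefs c a) /\
  forall z, normc z < 1 -> h z = PS (full_coefs c a) z.
Proof.
move=> /power_coefsP ha; have da := has_sum_disk_coefs ha; split=> // z z1.
by apply/esym/PSE => //; exact: ha.
Qed.

End operator.

Arguments disk_coefs_sign {R}.

(** * Polynomials with nonnegative real part on the unit circle *)

Section positive_real_part.
Variable R : realType.
Implicit Types (c p g : nat -> R[i]) (z w u : R[i]).

(** [X ^ n - 1] splits and is separable. *)
Lemma prim_root_exists n : (0 < n)%N -> exists w : R[i], n.-primitive_root w.
Proof.
move=> n_gt0; pose P : {poly R[i]} := 'X^n - 1.
have [r] := closed_field_poly_normal P.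
rewrite (monicP _) ?monicXnsubC // scale1r => DP.
have rn1 : all n.-unity_root r.
  by apply/allP => z; rewrite -root_prod_XsubC -DP.
have sz_r : (n < (size r).+1)%N by rewrite -(size_prod_XsubC r id) -DP size_XnsubC.
have [|w] := hasP (cyclic.has_prim_root n_gt0 rn1 _ sz_r); last by exists w.
by rewrite -separable_prod_XsubC -DP cyclotomic.separable_Xn_sub_1 // pnatr_eq0 -lt0n.
Qed.

Lemma normc_unity_root n w : (0 < n)%N -> w ^+ n = 1 -> normc w = 1.
Proof.
move=> n0 /(congr1 (@normc R)); rewrite normcX normc1 => /eqP.
by rewrite pexpr_eq1 ?normc_ge0 // => /eqP.
Qed.

Lemma sum_unity_root n w : w ^+ n = 1 ->
  \sum_(j < n) w ^+ j = (n * (w == 1))%:R.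
Proof.
move=> wn; have [->|w1] := eqVneq w 1.
  rewrite muln1; under eq_bigr do rewrite expr1n.
  by rewrite sumr_const card_ord.
rewrite muln0; apply/eqP; have := subrX1 w n; rewrite wn subrr => /esym/eqP.
by rewrite mulf_eq0 subr_eq0 (negPf w1).
Qed.

Lemma sum_mul_geometric n (w e : R[i]) p g M :
  \sum_(j < n) (\sum_(m < M.+1) p m * (w ^+ j) ^+ m) *
               (\sum_(l < M.+1) g l * (e ^+ j) ^+ l) =
  \sum_(m < M.+1) \sum_(l < M.+1) p m * g l * \sum_(j < n) (w ^+ m * e ^+ l) ^+ j.
Proof.
under eq_bigr do rewrite big_distrlr /=.
rewrite exchange_big; apply: eq_bigr => m _; rewrite exchange_big; apply: eq_bigr => l _.
rewrite mulr_sumr; apply: eq_bigr => j _.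
by rewrite exprMn mulrACA -!exprM [(j * _)%N]mulnC [(j * l)%N]mulnC.
Qed.

Lemma Re_mul_Re z w : complex.Re z * complex.Re w = complex.Re (z * w + z * conjc w) / 2.
Proof. by case: z w => a b [x y] /=; field. Qed.

(** The sum over the roots of unity [w ^ j] of
    [Re (P (w ^ j)) * Re (G (conjc w ^ j))] is nonnegative. As twice the product
    of the real parts is the real part of [P (G + conjc G)], orthogonality of
    characters evaluates it: [P G] contributes the coefficientwise product, and
    [P * conjc G] only its constant term. *)
Lemma poly_convolution_ge0 M p g :
  (forall u, normc u = 1 -> 0 <= complex.Re (\sum_(m < M.+1) p m * u ^+ m)) ->
  (forall u, normc u = 1 -> 0 <= complex.Re (\sum_(m < M.+1) g m * u ^+ m)) ->
  0 <= complex.Re (\sum_(m < M.+1) p m * g m + p 0%N * conjc (g 0%N)).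
Proof.
(* With more than [2 M] roots of unity no exponent [m + l] wraps around. *)
move=> hp hg; pose n := (M + M).+1; have n0 : (0 < n)%N by [].
have Mn : (M < n)%N by rewrite ltnS leq_addr.
have [w wn] := prim_root_exists n0.
have w1 : normc w = 1 by exact: normc_unity_root n0 (prim_expr_order wn).
have wX j : normc (w ^+ j) = 1 by rewrite normcX w1 expr1n.
have wJ : w * conjc w = 1 by rewrite mulc_conj w1 expr1n.
pose P j := \sum_(m < M.+1) p m * (w ^+ j) ^+ m.
pose G j := \sum_(l < M.+1) g l * (conjc w ^+ j) ^+ l.
have hPG : 0 <= \sum_(j < n) complex.Re (P j) * complex.Re (G j).
  apply: sumr_ge0 => j _; apply: mulr_ge0; first exact: hp.
  by apply: hg; rewrite -rmorphXn normc_conj.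
have GJ j : conjc (G j) = \sum_(l < M.+1) conjc (g l) * (w ^+ j) ^+ l.
  by rewrite rmorph_sum; apply: eq_bigr => l _; rewrite rmorphM !rmorphXn /= conjcK.
move: hPG; under eq_bigr do rewrite Re_mul_Re.
rewrite -mulr_suml -Re_sum big_split /= pmulr_lge0 ?invr_gt0 //.
under [X in _ + X]eq_bigr do rewrite GJ.
rewrite /P /G sum_mul_geometric (sum_mul_geometric _ _ _ p (fun l => conjc (g l))).
have -> : \sum_(m < M.+1) \sum_(l < M.+1) p m * g l *
     (\sum_(j < n) (w ^+ m * conjc w ^+ l) ^+ j) = n%:R * \sum_(m < M.+1) p m * g m.
  rewrite mulr_sumr; apply: eq_bigr => m _; rewrite (bigD1 m) //= [X in _ + X]big1 => [|l lm].
    by rewrite addr0 -exprMn wJ expr1n sum_unity_root ?expr1n // eqxx muln1 mulrC.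
  rewrite sum_unity_root; last first.
    rewrite exprMn -!exprM -rmorphXn mulnC [(l * n)%N]mulnC !exprM.
    by rewrite (prim_expr_order wn) !expr1n rmorph1 mulr1.
  have -> : (w ^+ m * conjc w ^+ l == 1) = false; last by rewrite muln0 mulr0.
  apply: contraNF lm => /eqP h; apply/eqP/val_inj => /=.
  have : w ^+ m == w ^+ l.
    by rewrite -[w ^+ l]mul1r -h -mulrA -exprMn [conjc w * _]mulrC wJ expr1n mulr1.
  rewrite (eq_prim_root_expr wn) !modn_small ?(leq_trans (ltn_ord _)) // => /eqP //.
have -> : \sum_(m < M.+1) \sum_(l < M.+1) p m * conjc (g l) *
     (\sum_(j < n) (w ^+ m * w ^+ l) ^+ j) = n%:R * (p 0%N * conjc (g 0%N)).
  have wnm m l : (w ^+ m * w ^+ l) ^+ n = 1.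
    by rewrite -exprD -exprM mulnC exprM (prim_expr_order wn) expr1n.
  rewrite (bigD1 ord0) //= [X in _ + X]big1 => [|m m0].
    rewrite addr0 (bigD1 ord0) //= [X in _ + X]big1 => [|l l0]; rewrite sum_unity_root ?wnm //.
      by rewrite !expr0 mulr1 eqxx muln1 addr0 mulrC.
    have -> : (w ^+ 0 * w ^+ l == 1) = false; last by rewrite muln0 mulr0.
    apply: negbTE; rewrite -exprD add0n -(prim_order_dvd wn) gtnNdvd ?lt0n //.
    by rewrite (leq_trans (ltn_ord l)).
  apply: big1 => l _; rewrite sum_unity_root ?wnm //.
  have -> : (w ^+ m * w ^+ l == 1) = false; last by rewrite muln0 mulr0.
  apply: negbTE; rewrite -exprD -(prim_order_dvd wn) gtnNdvd ?addn_gt0 ?lt0n ?m0 //.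
  by rewrite ltnS leq_add // -ltnS.
rewrite -mulrDr natC Re_mulrc pmulr_rge0 // ltr0n.
Qed.

End positive_real_part.

(** * The inequalities of Caratheodory and Harnack *)

Section caratheodory.
Variable R : realType.
Implicit Types (c g : nat -> R[i]) (z u : R[i]).

(** Convergence is uniform on smaller disks. *)
Lemma PS_tail c (r e : R) : disk_coefs c -> 0 <= r < 1 -> 0 < e ->
  \forall n \near \oo, forall z, normc z <= r ->
    normc (PS c z - \sum_(m < n) c m * z ^+ m) <= e.
Proof.
move=> dc r01 e0; have [r0 r1] := andP r01.
have [B hB] := disk_coefs_sum dc r01.
have cR : cvgn (series (fun m => normc (c m) * r ^+ m)).
  apply: (bounded_cvg_series (B := B)) => n; apply: le_trans (hB n).
  by apply: ler_sum => m _; rewrite ger0_norm // mulr_ge0 ?normc_ge0 ?exprn_ge0.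
have tm m : 0 <= normc (c m) * r ^+ m by rewrite mulr_ge0 ?normc_ge0 ?exprn_ge0.
have nd : nondecreasing_seq (series (fun m => normc (c m) * r ^+ m)).
  by apply/nondecreasing_seqP => n; rewrite seriesSr lerDl.
have /cvgrPdist_lt/(_ e e0) := cR; apply: filterS => n hn z zr.
have z1 : normc z < 1 by exact: le_lt_trans zr r1.
apply: has_sum_norm_le (has_sum_tail n (has_sum_PS dc z1)) _ => j.
apply: (@le_trans _ _ (\sum_(k < j) normc (c (n + k)%N) * r ^+ (n + k))).
  apply: ler_sum => k _; rewrite normcM normcX ler_wpM2l ?normc_ge0 //.
  by rewrite lerXn2r ?nnegrE ?normc_ge0.
have -> : \sum_(k < j) normc (c (n + k)%N) * r ^+ (n + k) =
   series (fun m => normc (c m) * r ^+ m) (n + j)%N - series (fun m => normc (c m) * r ^+ m) n.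
  by rewrite /series /= !big_mkord big_split_ord /= addrAC subrr add0r.
have h1 := nondecreasing_cvgn_le nd cR (n + j)%N.
have := le_lt_trans (ler_norm _) hn.
set L := limn _ in h1 *; set S1 := series _ _ in h1 *; set S2 := series _ n.
move=> h2; lra.
Qed.

(** Positivity on the circles of radius less than 1 passes to the coefficients
    themselves. *)
Lemma poly_left_limit_ge0 M (x : nat -> R) (y : R) :
  (forall r : R, 0 <= r < 1 -> 0 <= \sum_(m < M) x m * r ^+ m + y) ->
  0 <= \sum_(m < M) x m + y.
Proof.
move=> h; pose P : {poly R} := \poly_(m < M) x m + y%:P.
have PE r : P.[r] = \sum_(m < M) x m * r ^+ m + y.
  by rewrite /P hornerD hornerC horner_poly.
have -> : \sum_(m < M) x m + y = P.[1].
  by rewrite PE; congr (_ + _); apply: eq_bigr => m _; rewrite expr1n mulr1.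
have H : (fun r => P.[r]) @ 1^'- --> P.[1].
  by apply: cvg_at_left_filter; exact: continuous_horner.
apply: (cvgr_to_ge H).
by near=> r; rewrite PE h //; apply/andP; split; near: r;
  [exact: nbhs_left_ge|exact: nbhs_left_lt].
Unshelve. all: by end_near. Qed.

(** On a circle of radius [r < 1] a long partial sum, increased by a small
    constant, has nonnegative real part, and the polynomial statement applies;
    then the constant tends to 0 and [r] to 1. *)
Lemma PS_convolution_ge0 c g M : disk_coefs c ->
  (forall z, normc z < 1 -> 0 <= complex.Re (PS c z)) ->
  (forall u, normc u = 1 -> 0 <= complex.Re (\sum_(m < M.+1) g m * u ^+ m)) ->
  0 <= complex.Re (\sum_(m < M.+1) c m * g m + c 0%N * conjc (g 0%N)).
Proof.
move=> dc hc hg; rewrite ReD Re_sum.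
apply: (@poly_left_limit_ge0 _ (fun m => complex.Re (c m * g m))) => r r01.
have [r0 r1] := andP r01.
apply/ler_addgt0Pr => e e0.
pose K := 1 + 2 * `|complex.Re (g 0%N)|; pose e' := e / K.
have K0 : 0 < K by rewrite /K; have := normr_ge0 (complex.Re (g 0%N)); lra.
have e'0 : 0 < e' by rewrite divr_gt0.
have [n [Mn hn]] : exists n, (M <= n)%N /\ forall z, normc z <= r ->
    normc (PS c z - \sum_(m < n.+1) c m * z ^+ m) <= e'.
  have [[|n] [Mn hn]] := filter_ex (filterI (nbhs_infty_gt M) (PS_tail dc r01 e'0)).
    by [].
  by exists n.
(* [p] is the partial sum on the circle, raised by [e'] in its constant term;
   [g'] is [g] padded to the same length. *)
pose p m := c m * r%:C ^+ m + (if m == 0%N then e'%:C else 0).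
pose g' m := if (m <= M)%N then g m else 0.
have gE (q : nat -> R[i]) : \sum_(m < n.+1) g' m * q m = \sum_(m < M.+1) g m * q m.
  rewrite (big_ord_widen n.+1 (fun m => g m * q m)) ?ltnS // [RHS]big_mkcond /=.
  by apply: eq_bigr => m _; rewrite /g' ltnS; case: ifP => // _; rewrite mul0r.
have pE (q : nat -> R[i]) N : \sum_(m < N.+1) p m * q m =
   \sum_(m < N.+1) c m * r%:C ^+ m * q m + e'%:C * q 0%N.
  under eq_bigr do rewrite mulrDl.
  rewrite big_split /=; congr (_ + _); rewrite big_ord_recl /= big1 ?addr0 // => i _.
  by rewrite mul0r.
have hp u : normc u = 1 -> 0 <= complex.Re (\sum_(m < n.+1) p m * u ^+ m).
  move=> u1; rewrite pE expr0 mulr1 ReD.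
  have zr : normc (r%:C * u) = r by rewrite normcM u1 mulr1 normc_real ger0_norm.
  have := hn (r%:C * u); rewrite zr lexx => /(_ isT) h1.
  have := le_trans (Re_le_normc _) h1; rewrite ReB.
  have := hc (r%:C * u); rewrite zr => /(_ r1).
  under [in X in _ -> X -> _]eq_bigr do rewrite exprMn mulrA.
  by move=> h2 h3; rewrite /=; lra.
have hg' u : normc u = 1 -> 0 <= complex.Re (\sum_(m < n.+1) g' m * u ^+ m).
  by move=> u1; rewrite (gE (fun m => u ^+ m)) hg.
have := poly_convolution_ge0 hp hg'.
under eq_bigr do rewrite mulrC.
rewrite gE; under eq_bigr do rewrite mulrC.
rewrite pE /g' /p /= expr0 mulr1 !ReD Re_sum mulrDl ReD !Re_mulrc Re_conj.
have -> : \sum_(i < M.+1) complex.Re (c i * r%:C ^+ i * g i) =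
    \sum_(m < M.+1) complex.Re (c m * g m) * r ^+ m.
  by apply: eq_bigr => i _; rewrite mulrAC -realcX mulrC Re_mulrc mulrC.
have he : e' * (2 * complex.Re (g 0%N)) <= e.
  rewrite /e' mulrAC ler_pdivrMr // ler_wpM2l ?(ltW e0) // /K.
  by have := ler_norm (complex.Re (g 0%N)); lra.
by move=> H; lra.
Qed.

(** The test polynomial is [1 - u z ^ k], where [u] turns the coefficient into
    its modulus. *)
Lemma caratheodory_coef c k : disk_coefs c ->
  (forall z, normc z < 1 -> 0 <= complex.Re (PS c z)) ->
  (0 < k)%N -> normc (c k) <= 2 * complex.Re (c 0%N).
Proof.
move=> dc hc; case: k => // k _; have [u u1 uc] := phaseP (c k.+1).
pose g m := if m == 0%N then 1 else if m == k.+1 then - u else 0.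
have gE (q : nat -> R[i]) : \sum_(m < k.+2) g m * q m = q 0%N - u * q k.+1.
  rewrite big_ord_recl big_ord_recr /= big1 => [|i _].
    by rewrite add0r /g /bump /= eqxx mul1r mulNr.
  by rewrite /g /bump /= add1n eqSS (ltn_eqF (ltn_ord i)) mul0r.
have hg v : normc v = 1 -> 0 <= complex.Re (\sum_(m < k.+2) g m * v ^+ m).
  move=> v1; rewrite gE expr0 ReB /= subr_ge0; apply: le_trans (Re_le_normc _) _.
  by rewrite normcM normcX u1 v1 expr1n mulr1.
have := PS_convolution_ge0 dc hc hg; under eq_bigr do rewrite mulrC.
by rewrite gE /g eqxx conjc1 mulr1 uc ReD ReB /=; lra.
Qed.

(** Up to an affine change this is the minimum of the Poisson kernel on the
    circle of radius [normc x]. *)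
Lemma Re_inv_1B (x : R[i]) : normc x < 1 ->
  (1 + normc x)^-1 <= complex.Re (1 - x)^-1.
Proof.
move=> x1; have s0 := normc_ge0 x; set s := normc x in x1 s0 *.
have sE : s ^+ 2 = complex.Re x ^+ 2 + complex.Im x ^+ 2 by exact: normc_sqr.
have as1 := Re_le_normc x; have as2 := ReN_le_normc x; rewrite -/s in as1 as2.
have -> : complex.Re (1 - x)^-1 = (1 - complex.Re x) / (1 - 2 * complex.Re x + s ^+ 2).
  rewrite sE; case: {x1 s0 sE as1 as2 s} x => a b /=.
  by congr (_ / _); ring.
have D0 : 0 < 1 - 2 * complex.Re x + s ^+ 2 by nra.
rewrite ler_pdivlMr // ler_pdivrMl; last by lra.
nra.
Qed.

(** The test polynomial is half of the Poisson kernel minus its minimum, truncated,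
    and raised by [d] to compensate for the truncation. *)
Lemma harnack c z : disk_coefs c ->
  (forall z, normc z < 1 -> 0 <= complex.Re (PS c z)) -> normc z < 1 ->
  complex.Re (c 0%N) * (1 - normc z) / (1 + normc z) <= complex.Re (PS c z).
Proof.
move=> dc hc z1; set s := normc z; have s0 : 0 <= s by exact: normc_ge0.
have c00 : 0 <= complex.Re (c 0%N).
  have := hc 0; rewrite normc0 ltr01 => /(_ isT).
  by rewrite PS_cons ?mul0r ?addr0 // normc0.
apply/ler_addgt0Pr => e e0.
pose d := e / (1 + 2 * complex.Re (c 0%N)).
have d0 : 0 < d by rewrite divr_gt0 //; lra.
have z1' : 0 < 1 - s by rewrite subr_gt0.
have s01 : 0 <= s < 1 by rewrite s0.
have ds : 0 < d * (1 - s) by rewrite mulr_gt0.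
have hgeo : \forall n \near \oo, s ^+ n <= d * (1 - s).
  have : (fun n => s ^+ n) @ \oo --> (0 : R) by apply: cvg_expr; rewrite ger0_norm.
  move=> /cvgrPdist_lt /(_ _ ds); apply: filterS => n.
  by rewrite sub0r normrN ger0_norm ?exprn_ge0 // => /ltW.
have [[|n] [h1 [h2 h3]]] := filter_ex (filterI (nbhs_infty_gt 0%N)
  (filterI (PS_tail dc s01 d0) hgeo)); first by [].
pose g m := if m == 0%N then (s / (1 + s) + d)%:C else z ^+ m.
have hg u : normc u = 1 -> 0 <= complex.Re (\sum_(m < n.+1) g m * u ^+ m).
  move=> u1; pose x := z * u; have xs : normc x = s by rewrite normcM u1 mulr1.
  have -> : \sum_(m < n.+1) g m * u ^+ m = (s / (1 + s) + d - 1)%:C +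
     \sum_(m < n.+1) x ^+ m.
    rewrite !big_ord_recl /= !expr0 mulr1 addrA; congr (_ + _).
      by rewrite rmorphB /= rmorph1 subrK.
    by apply: eq_bigr => i _; rewrite exprMn.
  rewrite ReD /=; set G := \sum_(m < n.+1) x ^+ m.
  have x1 : 1 - x != 0.
    by apply: contraTneq z1 => /subr0_eq h; rewrite -/s -xs -h normc1 ltxx.
  have GE : G = (1 - x)^-1 - x ^+ n.+1 / (1 - x).
    apply: (mulIf x1); rewrite mulrBl mulVf // divfK //.
    by rewrite -[1 - x]opprB -[1 - x ^+ _]opprB subrX1 -/G mulrN mulrC.
  have xd : normc (x ^+ n.+1 / (1 - x)) <= d.
    rewrite normcM normcV normcX xs ler_pdivrMr.
      apply: le_trans h3 _; rewrite ler_wpM2l ?(ltW d0) //.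
      by apply: le_trans (normcB_ge _ _); rewrite normc1 xs.
    by apply: lt_le_trans z1' _; apply: le_trans (normcB_ge _ _); rewrite normc1 xs.
  have := @Re_inv_1B x; rewrite xs => /(_ z1) hx.
  have := le_trans (Re_le_normc _) xd.
  rewrite GE ReB => hd.
  have -> : s / (1 + s) = 1 - (1 + s)^-1 by field; lra.
  lra.
have := PS_convolution_ge0 dc hc hg.
have g0 : g 0%N = (s / (1 + s) + d)%:C by [].
rewrite big_ord_recl g0.
have -> : \sum_(i < n) c (lift ord0 i) * g (lift ord0 i) =
   \sum_(m < n.+1) c m * z ^+ m - c 0%N.
  by rewrite [RHS]addrC big_ord_recl expr0 mulr1 addKr; apply: eq_bigr.
rewrite conjc_real !ReD ReN ![c 0%N * _]mulrC Re_mulrc.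
have h4 : complex.Re (\sum_(m < n.+1) c m * z ^+ m) - complex.Re (PS c z) <= d.
  by rewrite -ReB (le_trans (Re_le_normc _)) // normcB h2.
move=> h5.
have h6 : 2 * complex.Re (c 0%N) * d + d = e.
  by rewrite /d; field; lra.
have -> : complex.Re (c 0%N) * (1 - s) / (1 + s) =
   complex.Re (c 0%N) - 2 * (s / (1 + s) * complex.Re (c 0%N)) by field; lra.
set q := s / (1 + s) in h5 *.
lra.
Qed.

End caratheodory.

(** * Inverting a first-order operator along a ray *)

Section averaging.
Variable R : realType.
Implicit Types (a : nat -> R[i]).

(** Shaped for minima reached at the right end of an interval, where only small
    steps to the left are allowed. *)
Lemma le0_of_quadratic (d C eta c : R) : 0 <= C -> 0 < eta -> 0 < c ->
  (forall s, 0 < s -> s < eta -> s <= c -> s * d <= C * s ^+ 2) -> d <= 0.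
Proof.
move=> C0 eta0 c0 h; apply/ler_addgt0Pr => e e0; rewrite add0r.
pose s := Num.min (eta / 2) (Num.min c (e / (C + 1))).
have C1 : 0 < C + 1 by lra.
have s0 : 0 < s by rewrite !lt_min c0 !divr_gt0.
have s1 : s < eta by rewrite /s gt_min; apply/orP; left; lra.
have sc : s <= c by rewrite /s !ge_min lexx !orbT.
have se : s * (C + 1) <= e by rewrite -ler_pdivlMr // /s !ge_min lexx !orbT.
have := h s s0 s1 sc; rewrite expr2 mulrCA ler_pM2l // => h4.
apply: le_trans h4 _; apply: le_trans se; rewrite mulrC ler_wpM2l ?(ltW s0) //; lra.
Qed.

(** Let [theta = t d/dt]. At a minimum of a function over [[0, t0]] its
    derivative is nonpositive, unless the minimum is at 0, where [theta]
    vanishes. So if the minimum is nonpositive, so is the value of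
    [al + ka * theta] there. *)
Lemma averaging_gt0 a (al ka : R) : disk_coefs a -> 0 < al -> 0 <= ka ->
  (forall t : R, 0 <= t < 1 ->
     0 < complex.Re (PS (fun m => (al + ka * m%:R)%:C * a m) t%:C)) ->
  forall t : R, 0 <= t < 1 -> 0 < complex.Re (PS a t%:C).
Proof.
move=> da al0 ka0 ha t0 /andP[t00 t01]; rewrite ltNge; apply/negP => ht0.
have nt (t : R) : 0 <= t -> t < 1 -> normc t%:C < 1.
  by move=> *; rewrite normc_real ger0_norm.
pose phi (t : R) := complex.Re (PS a t%:C).
have dphi (t : R) : 0 <= t -> t < 1 -> derivable (phi : R^o -> R^o) t 1.
  move=> h0 h1; have : normc (0 + t%:C * 1) < 1 by rewrite add0r mulr1 nt.
  move=> /(PS_line_derive 1 da) [h _].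
  rewrite (_ : phi = (fun s : R => complex.Re (1 * PS a (0 + s%:C * 1)))) //.
  by apply/funext => s; rewrite mul1r add0r mulr1.
have cphi : {within `[0, t0], continuous phi}%classic.
  apply: derivable_within_continuous => t; rewrite in_itv /= => /andP[h0 h1].
  by apply: dphi => //; exact: le_lt_trans t01.
have [c] := EVT_min t00 cphi; rewrite in_itv /= => /andP[c0 ct0] hc.
have c1 : c < 1 by exact: le_lt_trans t01.
have phic : phi c <= 0.
  by apply: le_trans (hc t0 _) ht0; rewrite in_itv /= t00 lexx.
have := ha c; rewrite c0 c1 => /(_ isT); rewrite PS_weight ?nt // ReD !Re_mulrc -/(phi c).
have [c_eq0|c_neq0] := eqVneq c 0.
  by rewrite {2}c_eq0 mul0r mulr0 addr0 pmulr_rgt0 // ltNge phic.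
have c_gt0 : 0 < c by rewrite lt_neqAle eq_sym c_neq0.
suff : complex.Re (PS (dcoef a) c%:C) <= 0.
  move=> d0; rewrite ltNge => /negP; apply; rewrite -[leRHS]addr0.
  by rewrite lerD ?mulr_ge0_le0 ?(ltW al0).
have [C [eta [C0 eta0 _ hC]]] := PS_taylor da (nt _ c0 c1).
apply: (le0_of_quadratic C0 eta0 c_gt0) => s s0 s1 sc.
have := hC (- s%:C); rewrite normcN normc_real gtr0_norm // => /(_ s1) h.
have cs : c%:C + - s%:C = (c - s)%:C by rewrite rmorphB.
rewrite cs in h; have := le_trans (Re_le_normc _) h.
rewrite !ReB mulNr ReN Re_mulrc opprK; apply: le_trans; rewrite lerDr subr_ge0.
by apply: hc; rewrite in_itv /= subr_ge0 sc (le_trans _ ct0) // gerBl ltW.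
Qed.

(** Adding a small constant reduces this to the strict inequality. *)
Lemma averaging_ge0 a (al ka : R) : disk_coefs a -> 0 < al -> 0 <= ka ->
  (forall t : R, 0 <= t < 1 ->
     0 <= complex.Re (PS (fun m => (al + ka * m%:R)%:C * a m) t%:C)) ->
  forall t : R, 0 <= t < 1 -> 0 <= complex.Re (PS a t%:C).
Proof.
move=> da al0 ka0 ha t t01; apply/ler_addgt0Pr => e e0.
have nt (s : R) : 0 <= s < 1 -> normc s%:C < 1.
  by move=> /andP[*]; rewrite normc_real ger0_norm.
pose d m : R[i] := if m == 0%N then e%:C else 0.
have dd : disk_coefs d := disk_coefs_const _.
have H s : 0 <= s < 1 -> complex.Re (PS (fun m => a m + d m) s%:C) = complex.Re (PS a s%:C) + e.
  by move=> s01; rewrite PSD ?nt // ReD PS_const ?nt.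
rewrite -(H t t01); apply: ltW.
apply: (@averaging_gt0 (fun m => a m + d m) al ka (disk_coefsD da dd) al0 ka0 _ t t01) => s s01.
have dw := disk_coefs_affine al ka da.
rewrite (@eq_PS _ _ (fun m => (al + ka * m%:R)%:C * a m + al%:C * d m)); last first.
  move=> m; rewrite mulrDr /d; case: eqP => [->|_]; first by rewrite mulr0 addr0.
  by rewrite !mulr0.
rewrite PSD ?nt //; last exact: disk_coefsZ.
rewrite PSZ ?nt // ReD PS_const ?nt // Re_mulrc /=.
by have := ha s s01; have := mulr_gt0 al0 e0; lra.
Qed.

End averaging.

(** * Analytic functions subject to the operator inequality *)

Section operator_inequality.
Variables (R : realType) (gamma delta lambda : R).
Hypotheses (lambda_ge0 : 0 <= lambda) (lambda_lt_gamma : lambda < gamma)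
  (gamma_le_delta : gamma <= delta).
Implicit Types (a c E : nat -> R[i]) (z w u : R[i]) (t : R).

Notation W := (op_weight gamma delta).

Lemma kappa_ge0 : 0 <= (delta - gamma) / 2.
Proof. by rewrite divr_ge0 // subr_ge0. Qed.

Lemma gamma_gt0 : 0 < gamma.
Proof. exact: le_lt_trans lambda_lt_gamma. Qed.

Lemma op_weight_ge k : gamma * k.+1%:R ^+ 2 <= W k.
Proof.
rewrite mulrC /op_weight ler_wpM2l ?exprn_ge0 //.
by rewrite lerDl mulr_ge0 // kappa_ge0.
Qed.

Lemma op_weight_gt0 k : 0 < W k.
Proof.
by apply: lt_le_trans (op_weight_ge k); rewrite mulr_gt0 ?gamma_gt0 ?exprn_gt0.
Qed.

Lemma disk_coefs_op_weight E : disk_coefs E -> disk_coefs (fun k => (W k)%:C * E k).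
Proof.
move=> dE; pose a m := if m is k.+1 then E k else 0.
have da : disk_coefs a.
  move=> r r01; have [B hB] := dE r r01; exists B => -[|m].
    by rewrite normc0 mul0r; apply: le_trans (hB 0%N); rewrite mulr_ge0 ?normc_ge0.
  have [r0 r1] := andP r01; apply: le_trans (hB m); rewrite exprS mulrCA.
  by rewrite ler_piMl ?mulr_ge0 ?normc_ge0 ?exprn_ge0 // ltW.
exact: (disk_coefs_weight gamma delta da).
Qed.

(** [E] stands for the function [z * PS E z], normalised at 0; its image under
    the third-order operator is the series with the weighted coefficients. *)
Definition analytic_class E := [/\ disk_coefs E, E 0%N = 1 &
  forall z, normc z < 1 -> lambda < complex.Re (PS (fun k => (W k)%:C * E k) z)].

Definition op_minus_lambda E k : R[i] :=
  (W k)%:C * E k - (if k == 0%N then lambda%:C else 0).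

Lemma op_weight0 : W 0 = gamma.
Proof. by rewrite /op_weight mulr0 addr0 expr1n mul1r. Qed.

Lemma disk_coefs_op_minus_lambda E : disk_coefs E -> disk_coefs (op_minus_lambda E).
Proof.
by move=> dE; exact: disk_coefsB (disk_coefs_op_weight dE) (disk_coefs_const _).
Qed.

Lemma PS_op_minus_lambda E z : disk_coefs E -> normc z < 1 ->
  PS (op_minus_lambda E) z = PS (fun k => (W k)%:C * E k) z - lambda%:C.
Proof.
move=> dE z1; rewrite -[X in _ = _ - X](PS_const lambda%:C z1).
exact: PSB (disk_coefs_op_weight dE) (disk_coefs_const _) z1.
Qed.

Lemma op_minus_lambda0 E : E 0%N = 1 -> op_minus_lambda E 0 = (gamma - lambda)%:C.
Proof. by move=> E0; rewrite /op_minus_lambda E0 mulr1 op_weight0 eqxx rmorphB. Qed.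

Lemma op_minus_lambda_ge0 E : analytic_class E ->
  forall z, normc z < 1 -> 0 <= complex.Re (PS (op_minus_lambda E) z).
Proof.
by move=> [dE E0 hE] z z1; rewrite PS_op_minus_lambda // ReB subr_ge0 ltW ?hE.
Qed.

Lemma analytic_class_coef E k : analytic_class E -> (0 < k)%N ->
  W k * normc (E k) <= 2 * (gamma - lambda).
Proof.
move=> hE k0; have [dE E0 _] := hE.
have := caratheodory_coef (disk_coefs_op_minus_lambda dE) (op_minus_lambda_ge0 hE) k0.
rewrite op_minus_lambda0 //= /op_minus_lambda gtn_eqF // subr0 normcM normc_real.
by rewrite gtr0_norm // op_weight_gt0.
Qed.

(** The coefficients [k.+1 * E k] are those of the derivative of [z * PS E z].
    Of the factors of the weight only [1 + theta] and [gamma + kap theta] are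
    left to remove. *)
Lemma analytic_class_deriv E : analytic_class E ->
  forall z, normc z < 1 -> 0 < complex.Re (PS (fun k => k.+1%:R * E k) z).
Proof.
move=> [dE E0 hE] z z1; have [w w1 ->] := polarP z.
have dS : disk_coefs (fun k => k.+1%:R * E k).
  apply: eq_disk_coefs (disk_coefsD dE (disk_coefsMn dE)) => m.
  by rewrite -natr1 mulrDl mul1r addrC.
rewrite PS_rotate; set t := normc z.
have t01 : 0 <= t < 1 by rewrite normc_ge0.
have dSw := disk_coefs_rotate w1 dS.
apply: (averaging_gt0 dSw gamma_gt0 kappa_ge0) t01 => {z z1} t t01.
set b := (fun m => _); have db : disk_coefs b by exact: disk_coefs_affine.
apply: (averaging_gt0 db ltr01 ler01) t01 => {}t t01.
have := hE (t%:C * w); rewrite normc_polar ?(andP t01).1 //.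
rewrite (andP t01).2 => /(_ isT) /(le_lt_trans lambda_ge0).
rewrite PS_rotate; congr (_ < complex.Re _); apply: eq_PS => k.
by rewrite /b !mulrA; congr (_ * _ * _); rewrite natC -!rmorphM; congr (_%:C);
  rewrite /op_weight -natr1; ring.
Qed.

(** The image of the extremal function under the operator is
    [lambda + (gamma - lambda) (1 - z) / (1 + z)], for which Harnack's
    inequality is an equality on the positive axis. *)
Definition ext_op k : R := if k == 0%N then gamma else 2 * (gamma - lambda) * (-1) ^+ k.

Definition ext_coef k : R := ext_op k / W k.

Lemma PS_ext_op z : normc z < 1 ->
  PS (fun k => (ext_op k)%:C) z =
    (2 * (gamma - lambda))%:C / (1 + z) - (gamma - 2 * lambda)%:C.
Proof.
move=> z1; rewrite -(PS_sign z1) -(PSZ _ disk_coefs_sign z1).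
rewrite -[X in _ = _ - X](PS_const _ z1).
rewrite -(PSB (disk_coefsZ _ disk_coefs_sign) (disk_coefs_const _) z1).
apply: eq_PS => -[|k]; rewrite /ext_op /=.
  by rewrite expr0 mulr1 -rmorphB; congr (_%:C); ring.
by rewrite subr0 rmorphM rmorphXn /= rmorphN1.
Qed.

Lemma disk_coefs_ext : disk_coefs (fun k => (ext_coef k)%:C).
Proof.
have [g0 gl] : 0 < gamma /\ 0 < gamma - lambda by rewrite subr_gt0 gamma_gt0.
apply: (disk_coefs_bounded (K := 2)) => k; rewrite normc_real /ext_coef normrM normfV.
rewrite [`|W k|]gtr0_norm ?op_weight_gt0 // ler_pdivrMr ?op_weight_gt0 //.
apply: (@le_trans _ _ (2 * gamma)).
  rewrite /ext_op; case: eqP => _; first by rewrite gtr0_norm //; lra.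
  rewrite normrM normrX normrN1 expr1n mulr1 gtr0_norm; last by lra.
  by have := lambda_ge0; lra.
rewrite ler_pM2l //; apply: le_trans (op_weight_ge k).
by rewrite ler_pMr // exprn_ege1 // ler1n.
Qed.

Lemma analytic_class_ext : analytic_class (fun k => (ext_coef k)%:C).
Proof.
split; first exact: disk_coefs_ext.
  by rewrite /ext_coef /ext_op /= op_weight0 divff // gt_eqF // gamma_gt0.
move=> z z1; rewrite (@eq_PS _ _ (fun k => (ext_op k)%:C)); last first.
  by move=> k; rewrite -rmorphM /ext_coef mulrC divfK // gt_eqF // op_weight_gt0.
rewrite PS_ext_op // ReB Re_mulrc /=.
have := @Re_inv_1B _ (- z); rewrite normcN opprK => /(_ z1) h.
have gl : 0 < gamma - lambda by rewrite subr_gt0.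
have h2 : 2^-1 < (1 + normc z)^-1.
  by have nz := normc_ge0 z; rewrite ltf_pV2 ?posrE; lra.
have h3 : 2^-1 < complex.Re (1 + z)^-1 by exact: lt_le_trans h.
have := mulr_gt0 gl (_ : 0 < complex.Re (1 + z)^-1 - 2^-1); rewrite subr_gt0 => /(_ h3).
lra.
Qed.

(** The difference of the two sides is a series along the ray; after three
    removals of a first-order factor its positivity becomes Harnack's
    inequality. *)
Lemma analytic_class_growth E w t : analytic_class E -> normc w = 1 -> 0 <= t < 1 ->
  complex.Re (PS (fun k => (ext_coef k)%:C) t%:C) <= complex.Re (PS E (t%:C * w)).
Proof.
move=> hE w1 t01; have [dE E0 _] := hE; rewrite PS_rotate -subr_ge0 -ReB.
have dEw := disk_coefs_rotate w1 dE.
have nt s : 0 <= s < 1 -> normc (s%:C : R[i]) < 1.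
  by move=> /andP[*]; rewrite normc_real ger0_norm.
pose d k := E k * w ^+ k - (ext_coef k)%:C.
have dd : disk_coefs d by exact: disk_coefsB dEw disk_coefs_ext.
have <- : PS d t%:C = PS (fun m => E m * w ^+ m) t%:C - PS (fun k => (ext_coef k)%:C) t%:C.
  exact: PSB dEw disk_coefs_ext (nt _ t01).
apply: (averaging_ge0 dd ltr01 ler01) t01 => {}t t01.
apply: (averaging_ge0 (disk_coefs_affine _ _ dd) ltr01 ler01) t01 => {}t t01.
apply: (averaging_ge0 (disk_coefs_affine _ _ (disk_coefs_affine _ _ dd))
  gamma_gt0 kappa_ge0) t01 => {}t t01.
have [t0 t1] := andP t01; have z1 : normc (t%:C * w) < 1 by rewrite normc_polar.
have := harnack (disk_coefs_op_minus_lambda dE) (op_minus_lambda_ge0 hE) z1.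
rewrite (op_minus_lambda0 E0) (PS_op_minus_lambda dE z1) ReB (normc_polar t0 w1).
rewrite [complex.Re (gamma - lambda)%:C]/= [complex.Re lambda%:C]/=.
have hV := PS_ext_op (nt _ t01).
have -> : PS (fun m => (gamma + (delta - gamma) / 2 * m%:R)%:C *
   ((1 + 1 * m%:R)%:C * ((1 + 1 * m%:R)%:C * d m))) t%:C =
   PS (fun k => (W k)%:C * E k) (t%:C * w) - PS (fun k => (ext_op k)%:C) t%:C.
  have dW := disk_coefs_rotate w1 (disk_coefs_op_weight dE).
  have dX : disk_coefs (fun k => (ext_op k)%:C).
    apply: eq_disk_coefs (disk_coefs_op_weight disk_coefs_ext) => k.
    by rewrite -rmorphM /ext_coef mulrC divfK // gt_eqF // op_weight_gt0.
  rewrite PS_rotate -(PSB dW dX (nt _ t01)).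
  apply: eq_PS => k; rewrite /d.
  have -> : (ext_op k)%:C = (W k)%:C * (ext_coef k)%:C.
    by rewrite -rmorphM /ext_coef mulrC divfK // gt_eqF // op_weight_gt0.
  rewrite -[_ * _ * w ^+ k]mulrA -mulrBr !mulrA -!rmorphM.
  by congr (_%:C * _); rewrite /op_weight -natr1; ring.
rewrite ReB hV ReB Re_mulrc.
have -> : complex.Re (1 + t%:C)^-1 = (1 + t)^-1.
  by rewrite -[1](rmorph1 (real_complex R)) -rmorphD -fmorphV.
have -> : (gamma - lambda) * (1 - t) / (1 + t) = 2 * (gamma - lambda) / (1 + t) - (gamma - lambda).
  by field; lra.
by rewrite /=; lra.
Qed.

End operator_inequality.

(** * Consequences for the harmonic class *)

Section harmonic_class.
Variables (R : realType) (gamma delta lambda : R).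
Hypotheses (lambda_ge0 : 0 <= lambda) (lambda_lt_gamma : lambda < gamma)
  (gamma_le_delta : gamma <= delta).
Variables (f h g : R[i]^o -> R[i]^o) (a b : nat -> R[i]).
Hypotheses (hf : class_RH0 gamma delta lambda f h g)
  (ha : power_coefs 1 a h) (hb : power_coefs 0 b g).
Implicit Types (z w u : R[i]) (t : R).

Notation W := (op_weight gamma delta).
Notation A := (full_coefs 1 a).
Notation B := (full_coefs 0 b).

(** Coefficients of [(h + u g) z / z]. *)
Definition combination u k : R[i] := A k.+1 + u * B k.+1.

Lemma class_fE z : normc z < 1 -> f z = PS A z + conjc (PS B z).
Proof.
move=> z1; have [[-> // _ _ _ _] _] := hf.
by rewrite (power_coefs_PS ha).2 // (power_coefs_PS hb).2.
Qed.

(** The operator inequality of the class bounds [T g] by [Re (T h) - lambda],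
    whatever unimodular factor is put in front of [T g]. *)
Lemma analytic_class_combination u : normc u = 1 ->
  analytic_class gamma delta lambda (combination u).
Proof.
move=> u1; have [dA hA] := power_coefs_PS ha; have [dB hB] := power_coefs_PS hb.
have dA' := disk_coefs_shift dA; have dB' := disk_coefsZ u (disk_coefs_shift dB).
split; first exact: disk_coefsD dA' dB'.
  by rewrite /combination /= mulr0 addr0.
move=> z z1; have [_ hcl] := hf.
have wA := disk_coefs_weight gamma delta dA.
have wB := disk_coefs_weight gamma delta dB.
have -> : PS (fun k => (W k)%:C * combination u k) z =
    third_order_op gamma delta h z + u * third_order_op gamma delta g z.
  rewrite (third_order_op_PS _ _ dA hA z1) (third_order_op_PS _ _ dB hB z1).
  rewrite -(PSZ u wB z1) -(PSD wA (disk_coefsZ u wB) z1).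
  by apply: eq_PS => k; rewrite /combination mulrDr [u * (_ * _)]mulrCA.
rewrite ReD; have := hcl z z1; rewrite ReB /= => h1.
have := ReN_le_normc (u * third_order_op gamma delta g z).
rewrite normcM u1 mul1r => h2; lra.
Qed.

Lemma combination_sum u z : normc u = 1 -> normc z < 1 ->
  PS A z + u * PS B z = z * PS (combination u) z.
Proof.
move=> u1 z1; have [dA _] := power_coefs_PS ha; have [dB _] := power_coefs_PS hb.
have dA' := disk_coefs_shift dA; have dB' := disk_coefs_shift dB.
rewrite (PS_cons dA z1) (PS_cons dB z1) /= !add0r mulrCA -mulrDr.
by rewrite -(PSZ u dB' z1) -(PSD dA' (disk_coefsZ u dB') z1).
Qed.

(** The unimodular number [q * conjc p] gives [a_m] and its multiple of [b_m] the
    same argument, so that their moduli add up. *)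
Lemma class_coef_le k : (0 < k)%N ->
  W k * (normc (a k.+1) + normc (b k.+1)) <= 2 * (gamma - lambda).
Proof.
case: k => // k _; have [p p1 pa] := phaseP (a k.+2); have [q q1 qb] := phaseP (b k.+2).
have u1 : normc (q * conjc p) = 1 by rewrite normcM normc_conj p1 q1 mulr1.
have := analytic_class_coef lambda_ge0 lambda_lt_gamma gamma_le_delta
  (analytic_class_combination u1) (ltn0Sn k).
rewrite /combination /=; rewrite -[X in _ * X <= _](mul1r) -{1}p1 -normcM mulrDr pa.
have -> : p * (q * conjc p * b k.+2) = (p * conjc p) * (q * b k.+2) by ring.
rewrite mulc_conj p1 expr1n mul1r qb.
by rewrite -rmorphD normc_real ger0_norm // addr_ge0 ?normc_ge0.
Qed.

(** The unimodular number is chosen to make the contribution of [g'] real and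
    nonpositive. *)
Lemma class_jacobian z : normc z < 1 ->
  normc (PS (dcoef B) z) < complex.Re (PS (dcoef A) z).
Proof.
move=> z1; have [dA _] := power_coefs_PS ha; have [dB _] := power_coefs_PS hb.
have dA' := disk_coefs_dcoef dA; have dB' := disk_coefs_dcoef dB.
have [u u1 uB] := phaseP (PS (dcoef B) z).
have Nu1 : normc (- u) = 1 by rewrite normcN.
have := analytic_class_deriv lambda_ge0 lambda_lt_gamma gamma_le_delta
  (analytic_class_combination Nu1) z1.
have -> : PS (fun k => k.+1%:R * combination (- u) k) z = PS (dcoef A) z + (- u) * PS (dcoef B) z.
  rewrite -(PSZ (- u) dB' z1) -(PSD dA' (disk_coefsZ (- u) dB') z1).
  by apply: eq_PS => k; rewrite /combination /dcoef mulrDr [_ * (- u * _)]mulrCA.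
by rewrite mulNr uB ReB /= subr_gt0.
Qed.

Definition growth_bound t : R :=
  t * complex.Re (PS (fun k => (ext_coef gamma delta lambda k)%:C) t%:C).

(** The real part does not see the conjugation of [conjc w * conjc (g z)], and
    [w * g z = conjc w * (w ^+ 2 * g z)]: the harmonic function is replaced by
    [h + w ^+ 2 g]. *)
Lemma class_growth w t : normc w = 1 -> 0 <= t < 1 ->
  growth_bound t <= complex.Re (conjc w * f (t%:C * w)).
Proof.
move=> w1 t01; have [t0 t1] := andP t01.
have z1 : normc (t%:C * w) < 1 by rewrite normc_polar.
have u1 : normc (w ^+ 2) = 1 by rewrite normcX w1 expr1n.
have -> : complex.Re (conjc w * f (t%:C * w)) = t * complex.Re (PS (combination (w ^+ 2)) (t%:C * w)).
  rewrite (class_fE z1) mulrDr ReD -rmorphM Re_conj -ReD.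
  have -> : conjc w * PS A (t%:C * w) + w * PS B (t%:C * w) =
      conjc w * (PS A (t%:C * w) + w ^+ 2 * PS B (t%:C * w)).
    by rewrite mulrDr expr2 !mulrA conjc_mul w1 expr1n mul1r.
  rewrite (combination_sum u1 z1) -mulrA mulrCA [conjc w * _]mulrA conjc_mul w1 expr1n mul1r.
  by rewrite Re_mulrc.
apply: (ler_wpM2l t0).
exact: (analytic_class_growth lambda_ge0 lambda_lt_gamma gamma_le_delta
  (analytic_class_combination u1) w1 t01).
Qed.

End harmonic_class.

(** * Covering by minimisation of the distance *)

Section covering.
Variable R : realType.
Implicit Types (a A B : nat -> R[i]) (z w k v : R[i]).

Lemma PS_lipschitz a z : disk_coefs a -> normc z < 1 ->
  exists L eta : R, [/\ 0 <= L, 0 < eta, normc z + eta < 1 &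
    forall k, normc k < eta -> normc (PS a (z + k) - PS a z) <= L * normc k].
Proof.
move=> da z1; have [C [eta [C0 eta0 etaz hC]]] := PS_taylor da z1.
exists (normc (PS (dcoef a) z) + C * eta), eta; split=> //.
  by rewrite addr_ge0 ?normc_ge0 // mulr_ge0 // ltW.
move=> k keta; have := hC k keta => h.
rewrite -[X in normc X](subrK (k * PS (dcoef a) z)).
apply: le_trans (normcD_le _ _) _; rewrite addrC mulrDl lerD //.
  by rewrite normcM mulrC.
apply: le_trans h _; rewrite expr2 mulrA ler_wpM2r ?normc_ge0 //.
by rewrite ler_wpM2l // ltW.
Qed.

Lemma compact_disk (rho : R) :
  compact [set p : R * R | p.1 ^+ 2 + p.2 ^+ 2 <= rho ^+ 2].
Proof.
apply: (@subclosed_compact _ _ (`[- `|rho|, `|rho|] `*` `[- `|rho|, `|rho|])).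
- pose q (p : R * R) : R := p.1 ^+ 2 + p.2 ^+ 2.
  have cq : continuous q.
    move=> p; apply: cvgD.
      apply: (@continuous_comp _ _ _ fst (fun x : R => x ^+ 2)); first exact: cvg_fst.
      exact: exprn_continuous.
    apply: (@continuous_comp _ _ _ snd (fun x : R => x ^+ 2)); first exact: cvg_snd.
    exact: exprn_continuous.
  rewrite (_ : mkset _ = q @^-1` [set x | x <= rho ^+ 2]) //.
  by move/continuous_closedP: cq; apply; exact: closed_le.
- by apply: compact_setX; exact: segment_compact.
- move=> [x y] /= h; have x2 := sqr_ge0 x; have y2 := sqr_ge0 y.
  have bd (s : R) : s ^+ 2 <= rho ^+ 2 -> s \in `[- `|rho|, `|rho|].
    by move=> hs; rewrite in_itv /= -ler_norml -(@ler_pXn2r _ 2) ?nnegrE // !real_normK ?num_real.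
  by split; apply: bd; lra.
Qed.

Lemma normcD_sqr z w :
  normc (z + w) ^+ 2 = normc z ^+ 2 + 2 * complex.Re (conjc z * w) + normc w ^+ 2.
Proof. by rewrite !normc_sqr; case: z w => x1 y1 [x2 y2] /=; ring. Qed.

(** The compactness is that of the disks of [R * R]. *)
Lemma exists_nearest (f : R[i] -> R[i]) (rho : R) v : 0 <= rho ->
  (forall z, normc z <= rho -> exists L eta : R, [/\ 0 <= L, 0 < eta &
    forall k, normc k < eta -> normc (f (z + k) - f z) <= L * normc k]) ->
  exists2 z, normc z <= rho &
    forall z', normc z' <= rho -> normc (f z - v) <= normc (f z' - v).
Proof.
move=> rho0 lf; pose K := [set p : R * R | p.1 ^+ 2 + p.2 ^+ 2 <= rho ^+ 2].
have KE (p : R * R) : K p <-> normc (p.1 +i* p.2) <= rho.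
  have -> : (normc (p.1 +i* p.2) <= rho) = (normc (p.1 +i* p.2) ^+ 2 <= rho ^+ 2).
    by rewrite ler_pXn2r ?nnegrE ?normc_ge0.
  by rewrite normc_sqr.
pose N (p : R * R) := normc (f (p.1 +i* p.2) - v).
have K0 : K !=set0 by exists (0, 0); rewrite /K /= expr0n addr0 sqr_ge0.
have cN : {within K, continuous N}.
  apply: continuous_in_subspaceT => p; rewrite inE => /KE hp.
  have [L [eta [L0 eta0 hL]]] := lf _ hp.
  apply/cvgrPdist_lt => e e0.
  pose d := Num.min (eta / 2) (e / (2 * (L + 1))).
  have L1 : 0 < 2 * (L + 1) by lra.
  have d0 : 0 < d by rewrite lt_min !divr_gt0.
  have d1 : d <= eta / 2 by rewrite ge_min lexx.
  have d2 : d * (2 * (L + 1)) <= e by rewrite -ler_pdivlMr // ge_min lexx orbT.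
  exists (ball p.1 d, ball p.2 d); first by split; exact: nbhsx_ballx.
  move=> [x y] [/= hx hy]; rewrite /ball /= in hx hy.
  pose k := (x - p.1) +i* (y - p.2).
  have zk : p.1 +i* p.2 + k = x +i* y.
    by rewrite /k; apply/eqP; rewrite eq_complex /= ![_ + (_ - _)]addrC !subrK !eqxx.
  have kd : normc k < d + d.
    apply: le_lt_trans (normc_le_Re_Im _) _; rewrite /k /=.
    by rewrite ltrD // distrC.
  have ke : normc k < eta by lra.
  have := hL k ke; rewrite zk => h; rewrite /N /=.
  apply: le_lt_trans (_ : _ <= normc (f (x +i* y) - f (p.1 +i* p.2))) _.
    rewrite ler_norml lerNl opprB; apply/andP; split.
      by rewrite (le_trans (normcB_ge _ _)) // opprB addrA subrK.
    by rewrite (le_trans (normcB_ge _ _)) // opprB addrA subrK normcB.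
  apply: le_lt_trans h _; have := normc_ge0 k => k0.
  have h1 : L * normc k <= L * (d + d) by rewrite ler_wpM2l // ltW.
  lra.
have [p] := compact_EVT_min K0 (@compact_disk rho) cN.
rewrite inE => /KE hp hmin; exists (p.1 +i* p.2) => // z hz.
have := hmin (complex.Re z, complex.Im z); rewrite inE /N /=.
have -> : complex.Re z +i* complex.Im z = z by case: (z).
by apply; apply/KE => /=; case: (z) hz.
Qed.

Lemma normc_le_of_sqr (x y c : R) : 0 < y -> x ^+ 2 <= y ^+ 2 + c -> x <= y + c / (2 * y).
Proof.
move=> y0 h; have := sqr_ge0 (x - y); rewrite sqrrB => h2.
rewrite -(ler_pM2l (_ : 0 < 2 * y)); last lra.
rewrite mulrDr mulrCA divff ?mulr1; last by rewrite mulf_neq0 // gt_eqF.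
by rewrite !expr2 in h h2; lra.
Qed.

(** The counterpart of [PS_taylor] for the sum of a holomorphic and an
    antiholomorphic series. *)
Lemma harmonic_local A B z : disk_coefs A -> disk_coefs B -> normc z < 1 ->
  exists C eta : R, [/\ 0 <= C, 0 < eta, normc z + eta < 1 &
    forall k, normc k < eta ->
      normc (PS A (z + k) + conjc (PS B (z + k)) - (PS A z + conjc (PS B z)) -
        (k * PS (dcoef A) z + conjc (k * PS (dcoef B) z))) <= C * normc k ^+ 2].
Proof.
move=> dA dB z1.
have [C1 [e1 [C10 e10 ez1 h1]]] := PS_taylor dA z1.
have [C2 [e2 [C20 e20 ez2 h2]]] := PS_taylor dB z1.
exists (C1 + C2), (Num.min e1 e2); split.
- by rewrite addr_ge0.
- by rewrite lt_min e10 e20.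
- by apply: le_lt_trans ez1; rewrite lerD2l ge_min lexx.
move=> k; rewrite lt_min => /andP[k1 k2].
set X := (X in normc X).
have -> : X = (PS A (z + k) - PS A z - k * PS (dcoef A) z) +
   conjc (PS B (z + k) - PS B z - k * PS (dcoef B) z).
  have regroup (p1 q1 p0 q0 x y : R[i]) :
    p1 + q1 - (p0 + q0) - (x + y) = (p1 - p0 - x) + (q1 - q0 - y) by ring.
  by rewrite /X !conjcB; exact: regroup.
rewrite (le_trans (normcD_le _ _)) // normc_conj mulrDl lerD //; [exact: h1|exact: h2].
Qed.

(** Let [z] be a point of the closed disk where [w = f z - v] has the least modulus,
    and suppose that [w] is not 0. The derivative of [f] in the direction [w] has a
    positive component along [w], because the holomorphic part dominates; so
    [z - s w] has a smaller error for small [s > 0]. It stays in the disk, because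
    on the boundary circle the last hypothesis makes [w] point outwards. *)
Lemma covering A B (f : R[i] -> R[i]) (rho : R) v :
  disk_coefs A -> disk_coefs B -> 0 <= rho < 1 ->
  (forall z, normc z < 1 -> f z = PS A z + conjc (PS B z)) ->
  (forall z, normc z < 1 -> normc (PS (dcoef B) z) < complex.Re (PS (dcoef A) z)) ->
  (forall z, normc z = rho -> normc v * rho < complex.Re (conjc z * f z)) ->
  exists2 z, normc z <= rho & f z = v.
Proof.
move=> dA dB /andP[rho0 rho1] fE jac hbd.
have lf z : normc z <= rho -> exists L eta : R, [/\ 0 <= L, 0 < eta &
    forall k, normc k < eta -> normc (f (z + k) - f z) <= L * normc k].
  move=> zr; have z1 : normc z < 1 by exact: le_lt_trans rho1.
  have [L1 [e1 [L10 e10 ez1 h1]]] := PS_lipschitz dA z1.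
  have [L2 [e2 [L20 e20 ez2 h2]]] := PS_lipschitz dB z1.
  exists (L1 + L2), (Num.min e1 e2); split; first by rewrite addr_ge0.
    by rewrite lt_min e10 e20.
  move=> k; rewrite lt_min => /andP[k1 k2].
  have zk : normc (z + k) < 1.
    by apply: le_lt_trans (normcD_le _ _) _; apply: lt_trans ez1; rewrite ltrD2l.
  rewrite !fE // opprD addrACA -conjcB (le_trans (normcD_le _ _)) //.
  by rewrite normc_conj mulrDl (lerD (h1 k k1) (h2 k k2)).
have [z zr hmin] := exists_nearest v rho0 lf.
have z1 : normc z < 1 by exact: le_lt_trans rho1.
exists z => //; apply/eqP; rewrite -subr_eq0; apply: contraT.
set w := f z - v => w0.
have nw0 : 0 < normc w.
  by rewrite lt_neqAle normc_ge0 andbT eq_sym; apply: contra w0 => /eqP/eq0_normc ->.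
have [s1 s10 hs1] : exists2 s1 : R, 0 < s1 &
    forall s, 0 < s -> s <= s1 -> normc (z + - (s%:C * w)) <= rho.
  have [zlt|zge] := ltP (normc z) rho.
    exists ((rho - normc z) / normc w); first by rewrite divr_gt0 // subr_gt0.
    move=> s s0; rewrite ler_pdivlMr // => hs.
    apply: le_trans (normcD_le _ _) _; rewrite normcN normcM normc_real gtr0_norm //.
    by rewrite -lerBrDl.
  have zE : normc z = rho by apply/eqP; rewrite eq_le zr zge.
  have zw : 0 < complex.Re (conjc z * w).
    rewrite /w mulrBr ReB subr_gt0; apply: le_lt_trans (hbd z zE).
    by rewrite (le_trans (Re_le_normc _)) // normcM normc_conj zE mulrC.
  exists (2 * complex.Re (conjc z * w) / normc w ^+ 2).
    by rewrite divr_gt0 ?mulr_gt0 ?exprn_gt0.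
  move=> s s0; rewrite ler_pdivlMr ?exprn_gt0 // => hs.
  rewrite -(@ler_pXn2r _ 2) ?nnegrE ?normc_ge0 // normcD_sqr normcN zE.
  rewrite mulrN ReN mulrCA Re_mulrc normcM normc_real gtr0_norm //.
  have := ler_wpM2l (ltW s0) hs; rewrite exprMn !expr2; lra.
have [C [eta [C0 eta0 etaz hC]]] := harmonic_local dA dB z1.
set a' := PS (dcoef A) z in hC; set b' := PS (dcoef B) z in hC.
have hC' k : normc k < eta -> normc (z + k) < 1 ->
    normc (f (z + k) - f z - (k * a' + conjc (k * b'))) <= C * normc k ^+ 2.
  by move=> ke kz; rewrite (fE _ kz) (fE z z1); exact: hC.
pose m := complex.Re a' - normc b'.
have m0 : 0 < m by rewrite subr_gt0; exact: jac.
pose q := w * a' + conjc (w * b').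
have hq : m * normc w ^+ 2 <= complex.Re (conjc w * q).
  rewrite /q mulrDr ReD mulrA conjc_mul Re_mulrc -conjcM Re_conj /m.
  have := ReN_le_normc (w * (w * b')); rewrite !normcM !expr2; lra.
have : m * normc w <= 0.
  have e10 : 0 < eta / normc w by rewrite divr_gt0.
  have K0 : 0 <= normc q ^+ 2 / (2 * normc w) + C * normc w ^+ 2.
    by rewrite addr_ge0 ?divr_ge0 ?mulr_ge0 ?exprn_ge0 ?normc_ge0.
  apply: (le0_of_quadratic K0 e10 s10) => s s0 sw ss1.
  have ks : normc (- (s%:C * w)) < eta.
    by rewrite normcN normcM normc_real gtr0_norm // -ltr_pdivlMr.
  have zs := hs1 s s0 ss1.
  have := hC' _ ks (le_lt_trans zs rho1).
  have := hmin _ zs.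
  set f1 := f (z + - _); rewrite -/w.
  have -> : - (s%:C * w) * a' + conjc (- (s%:C * w) * b') = - (s%:C * q).
    have mC (x : R) : - (x%:C * w) * a' + conjc (- (x%:C * w) * b') = - (x%:C * q).
      rewrite !mulNr conjcN -[_ * w * a']mulrA -[_ * w * b']mulrA.
      by rewrite [conjc (x%:C * _)]conjcM conjc_real -opprD -mulrDr.
    exact: mC.
  rewrite opprK normcN normcM normc_real gtr0_norm // => hmin1 herr.
  have hf1 : normc (f1 - v) <= normc (w + - (s%:C * q)) + C * (s * normc w) ^+ 2.
    have -> : f1 - v = (w + - (s%:C * q)) + (f1 - f z + s%:C * q) by rewrite /w; ring.
    by rewrite (le_trans (normcD_le _ _)) // lerD2l.
  have : normc (w + - (s%:C * q)) ^+ 2 <=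
      normc w ^+ 2 + (s ^+ 2 * normc q ^+ 2 - 2 * s * (m * normc w ^+ 2)).
    rewrite normcD_sqr normcN normcM normc_real gtr0_norm // exprMn.
    rewrite mulrN ReN mulrCA Re_mulrc.
    have := ler_wpM2l (ltW s0) hq; lra.
  move=> /(normc_le_of_sqr nw0) hw.
  have hd : (s ^+ 2 * normc q ^+ 2 - 2 * s * (m * normc w ^+ 2)) / (2 * normc w) =
      s ^+ 2 * (normc q ^+ 2 / (2 * normc w)) - s * (m * normc w).
    by field; rewrite gt_eqF.
  have := le_trans hmin1 (le_trans hf1 (lerD hw (lexx _))); rewrite hd exprMn.
  move: (m * normc w) (normc q ^+ 2 / (2 * normc w)) (normc w) => M Q N; lra.
by rewrite pmulr_lle0 // leNgt m0.
Qed.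

End covering.

(** * Monotonicity when the derivative has positive real part *)

Section univalence.
Variable R : realType.
Implicit Types (a : nat -> R[i]) (z : R[i]).

(** The mean value theorem on the segment from [z2] to [z1]. *)
Lemma PS_strict_mono a z1 z2 : disk_coefs a ->
  (forall z, normc z < 1 -> 0 < complex.Re (PS (dcoef a) z)) ->
  normc z1 < 1 -> normc z2 < 1 -> z1 != z2 ->
  0 < complex.Re (conjc (z1 - z2) * (PS a z1 - PS a z2)).
Proof.
move=> da ha h1 h2 z12; set k := z1 - z2.
have k0 : 0 < normc k ^+ 2.
  rewrite exprn_gt0 // lt_neqAle normc_ge0 andbT eq_sym.
  by apply: contra z12 => /eqP/eq0_normc/eqP; rewrite subr_eq0.
have hD (t : R) : 0 <= t <= 1 -> normc (z2 + t%:C * k) < 1.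
  move=> /andP[t0 t1]; have -> : z2 + t%:C * k = (1 - t)%:C * z2 + t%:C * z1.
    by rewrite rmorphB rmorph1 /k; ring.
  apply: le_lt_trans (normcD_le _ _) _; rewrite !normcM !normc_real.
  rewrite !ger0_norm ?subr_ge0 //.
  have [->|t00] := eqVneq t 0; first by rewrite mul0r addr0 subr0 mul1r.
  have tt : 0 < t by rewrite lt_neqAle eq_sym t00.
  have e1 : t * normc z1 < t by rewrite gtr_pMr.
  have e2 : (1 - t) * normc z2 <= 1 - t by rewrite ler_piMr ?subr_ge0 // ltW.
  lra.
pose phi (t : R) : R := complex.Re (conjc k * PS a (z2 + t%:C * k)).
pose dphi (t : R) : R := complex.Re (conjc k * (k * PS (dcoef a) (z2 + t%:C * k))).
have dd (t : R) : 0 <= t <= 1 -> is_derive (t : R^o) (1 : R^o) (phi : R^o -> R^o) (dphi t).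
  by move=> t01; apply: PS_line_derive => //; exact: hD.
have dphiP x : x \in `]0, 1[ -> is_derive (x : R^o) (1 : R^o) (phi : R^o -> R^o) (dphi x).
  by rewrite in_itv /= => /andP[x0 x1]; apply: dd; rewrite !ltW.
have cphi : {within `[0, 1], continuous phi}.
  apply: derivable_within_continuous => t; rewrite in_itv /= => t01.
  by have [] := dd t t01.
have [c] := MVT ltr01 dphiP cphi; rewrite in_itv /= subr0 mulr1 => /andP[c0 c1].
rewrite /phi /dphi -ReB -mulrBr mul1r mul0r addr0.
have -> : z2 + k = z1 by rewrite /k addrC subrK.
move=> ->; rewrite mulrA conjc_mul Re_mulrc mulr_gt0 // ha // hD //.
by rewrite !ltW.
Qed.

End univalence.

(** * The boundary value of the extremal function *)

Section extremal_value.
Variables (R : realType) (gamma delta lambda : R).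
Hypotheses (lambda_ge0 : 0 <= lambda) (lambda_lt_gamma : lambda < gamma)
  (gamma_le_delta : gamma <= delta).
Implicit Types (t : R).

Notation W := (op_weight gamma delta).
Notation ec := (ext_coef gamma delta lambda).
Notation L := (growth_bound gamma delta lambda).

Definition ext_fun_coef (m : nat) : R[i] := if m is k.+1 then (ec k)%:C else 0.

(** The right-hand side of the radius equation, as the value at 1 of the extremal
    growth bound. *)
Definition ext_value : R := limn (series ec).

Lemma sum_inv_sqr_le n : \sum_(k < n) (k.+1%:R ^+ 2)^-1 <= 2 :> R.
Proof.
case: n => [|n]; first by rewrite big_ord0.
suff h : \sum_(k < n.+1) (k.+1%:R ^+ 2)^-1 <= 2 - n.+1%:R^-1 :> R.
  by apply: le_trans h _; rewrite gerBl invr_ge0.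
elim: n => [|n IH]; first by rewrite big_ord1 expr1n invr1; lra.
rewrite big_ord_recr /=; apply: le_trans (lerD IH (lexx _)) _.
set x : R := n.+1%:R; have x0 : 0 < x by rewrite ltr0n.
have -> : n.+2%:R = x + 1 :> R by rewrite natr1.
have x1 : 0 < x + 1 by lra.
have -> : ((x + 1) ^+ 2)^-1 = (x^-1 - (x + 1)^-1) - (x * (x + 1) ^+ 2)^-1.
  by field; rewrite !gt_eqF.
have : 0 <= (x * (x + 1) ^+ 2)^-1 by rewrite invr_ge0 mulr_ge0 ?exprn_ge0 // ltW.
move: (x * _)^-1 x^-1 (x + 1)^-1 => u1 u2 u3; lra.
Qed.

Lemma ext_coef_le k : `|ec k| <= 2 * (k.+1%:R ^+ 2)^-1.
Proof.
have g0 := gamma_gt0 lambda_ge0 lambda_lt_gamma.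
have w0 := op_weight_gt0 lambda_ge0 lambda_lt_gamma gamma_le_delta k.
rewrite normrM normfV [`|W k|]gtr0_norm // ler_pdivrMr //.
have k0 : 0 < k.+1%:R ^+ 2 :> R by rewrite exprn_gt0.
rewrite mulrAC ler_pdivlMr //.
apply: (@le_trans _ _ (2 * gamma * k.+1%:R ^+ 2)).
  rewrite ler_wpM2r ?(ltW k0) // /ext_op; case: eqP => _.
    by rewrite gtr0_norm //; lra.
  rewrite normrM normrX normrN1 expr1n mulr1 gtr0_norm; first by have := lambda_ge0; lra.
  by rewrite mulr_gt0 // subr_gt0.
by rewrite -mulrA ler_wpM2l // op_weight_ge.
Qed.

Lemma sum_norm_ext_coef_le n : \sum_(k < n) `|ec k| <= 4.
Proof.
apply: (@le_trans _ _ (2 * \sum_(k < n) (k.+1%:R ^+ 2)^-1)).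
  by rewrite mulr_sumr; apply: ler_sum => k _; exact: ext_coef_le.
by have := sum_inv_sqr_le n; lra.
Qed.

Lemma ext_value_cvg : series ec @ \oo --> ext_value.
Proof. exact: (bounded_cvg_series sum_norm_ext_coef_le). Qed.

(** Abel's theorem; the series converges absolutely, so uniformly in [t]. *)
Lemma growth_bound_cvg : L t @[t --> 1^'-] --> ext_value.
Proof.
apply/cvgrPdist_lt => e e0; have e4 : 0 < e / 4 by lra.
have dX := disk_coefs_ext lambda_ge0 lambda_lt_gamma gamma_le_delta.
pose N k : R := `|ec k|.
have cN : cvgn (series N).
  apply: (bounded_cvg_series (B := 4)) => n.
  by apply: le_trans (sum_norm_ext_coef_le n); apply: ler_sum => k _; rewrite normr_id.
have nd : nondecreasing_seq (series N).
  by apply/nondecreasing_seqP => n; rewrite seriesSr lerDl normr_ge0.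
have hN : \forall n \near \oo, `|limn (series N) - series N n| < e / 4.
  by move/cvgrPdist_lt: cN; apply.
have hD : \forall n \near \oo, `|ext_value - series ec n| < e / 4.
  by move/cvgrPdist_lt: ext_value_cvg; apply.
have [n [{}hN {}hD]] := filter_ex (filterI hN hD).
(* [P] is a partial sum of the growth bound; it is continuous at 1, and the rest is
   small uniformly in [t]. *)
pose P : {poly R} := 'X * \poly_(k < n) ec k.
have PE t : P.[t] = t * \sum_(k < n) ec k * t ^+ k.
  by rewrite hornerM hornerX horner_poly.
have P1 : P.[1] = series ec n.
  rewrite PE mul1r /series /= big_mkord.
  by apply: eq_bigr => k _; rewrite expr1n mulr1.
have cP : (fun t => P.[t]) @ 1^'- --> P.[1].
  by apply: cvg_at_left_filter; exact: continuous_horner.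
have hP : \forall t \near 1^'-, `|P.[1] - P.[t]| < e / 4.
  by move/cvgrPdist_lt: cP; apply.
near=> t; have t0 : 0 <= t by near: t; exact: nbhs_left_ge.
have t1 : t < 1 by near: t; exact: nbhs_left_lt.
have hPt : `|P.[1] - P.[t]| < e / 4 by near: t; exact: hP.
have z1 : normc (t%:C : R[i]) < 1 by rewrite normc_real ger0_norm.
have hL : `|P.[t] - L t| <= e / 4.
  rewrite distrC PE /growth_bound -mulrBr normrM ger0_norm //.
  apply: le_trans (_ : _ <= `|complex.Re (PS (fun k => (ec k)%:C) t%:C) -
     \sum_(k < n) ec k * t ^+ k|) _; first by rewrite ler_piMl // ltW.
  have -> : \sum_(k < n) ec k * t ^+ k = complex.Re (\sum_(k < n) (ec k)%:C * t%:C ^+ k).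
    by rewrite Re_sum; apply: eq_bigr => k _; rewrite -realcX -rmorphM.
  rewrite -ReB; apply: le_trans (normRe_le _) _.
  apply: has_sum_norm_le (has_sum_tail n (has_sum_PS dX z1)) _ => j.
  apply: (@le_trans _ _ (\sum_(k < j) N (n + k)%N)).
    apply: ler_sum => k _; rewrite normcM normcX !normc_real [`|t|]ger0_norm //.
    by rewrite ler_piMr // exprn_ile1 // ltW.
  have -> : \sum_(k < j) N (n + k)%N = series N (n + j)%N - series N n.
    by rewrite /series /= !big_mkord big_split_ord /= addrAC subrr add0r.
  have h1 := nondecreasing_cvgn_le nd cN (n + j)%N.
  have h2 := le_lt_trans (ler_norm _) hN.
  apply: ltW; apply: le_lt_trans h2; exact: lerB h1 (lexx _).
have -> : ext_value - L t = (ext_value - series ec n) + (P.[1] - P.[t]) + (P.[t] - L t).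
  by rewrite P1; ring.
apply: le_lt_trans (ler_normD _ _) _; apply: le_lt_trans (lerD (ler_normD _ _) (lexx _)) _.
lra.
Unshelve. all: by end_near. Qed.

Lemma disk_coefs_ext_fun_coef : disk_coefs ext_fun_coef.
Proof.
apply: (disk_coefs_bounded (K := 4)) => -[|k]; first by rewrite normc0.
rewrite normc_real; apply: le_trans (sum_norm_ext_coef_le k.+1).
by rewrite big_ord_recr /= lerDr sumr_ge0.
Qed.

Lemma growth_boundE t : 0 <= t < 1 -> L t = complex.Re (PS ext_fun_coef t%:C).
Proof.
move=> /andP[t0 t1].
rewrite (PS_cons disk_coefs_ext_fun_coef) ?normc_real ?ger0_norm //.
by rewrite add0r Re_mulrc.
Qed.

Lemma ext_fun_coef_deriv_gt0 (z : R[i]) : normc z < 1 -> 0 < complex.Re (PS (dcoef ext_fun_coef) z).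
Proof.
exact: (analytic_class_deriv lambda_ge0 lambda_lt_gamma gamma_le_delta
  (analytic_class_ext lambda_ge0 lambda_lt_gamma gamma_le_delta)).
Qed.

Lemma growth_bound_lt (s t : R) : 0 <= s -> s < t -> t < 1 -> L s < L t.
Proof.
move=> s0 st t1; have t0 : 0 <= t by exact: le_trans (ltW st).
have s1 : s < 1 by exact: lt_trans t1.
rewrite !growth_boundE ?s0 ?t0 //.
have nr (x : R) : 0 <= x -> x < 1 -> normc (x%:C : R[i]) < 1.
  by move=> *; rewrite normc_real ger0_norm.
have ts : t%:C != s%:C :> R[i] by rewrite (inj_eq (@complexI R)) gt_eqF.
have := PS_strict_mono disk_coefs_ext_fun_coef ext_fun_coef_deriv_gt0 (nr _ t0 t1) (nr _ s0 s1) ts.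
by rewrite -rmorphB conjc_real Re_mulrc ReB pmulr_rgt0 ?subr_gt0.
Qed.

Lemma growth_bound_le_value t : 0 <= t < 1 -> L t <= ext_value.
Proof.
move=> /andP[t0 t1]; apply: (cvgr_to_ge growth_bound_cvg).
near=> s; have ts : t < s by near: s; exact: nbhs_left_gt.
by rewrite ltW // growth_bound_lt //; near: s; exact: nbhs_left_lt.
Unshelve. all: by end_near. Qed.

Lemma ext_value_gt0 : 0 < ext_value.
Proof.
have h : L 0 < L 2^-1 by apply: growth_bound_lt => //; lra.
have L0 : L 0 = 0 by rewrite /growth_bound mul0r.
rewrite L0 in h; apply: lt_le_trans h _.
by apply: growth_bound_le_value; apply/andP; split; lra.
Qed.

(** The identity satisfies the operator inequality, so its growth dominates the
    extremal growth. *)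
Lemma ext_value_le1 : ext_value <= 1.
Proof.
apply: (cvgr_to_le growth_bound_cvg); near=> t.
have t0 : 0 <= t by near: t; exact: nbhs_left_ge.
have t1 : t < 1 by near: t; exact: nbhs_left_lt.
have d1 := disk_coefs_const (1 : R[i]).
have id_pos : analytic_class gamma delta lambda (fun m => if m == 0%N then 1 else 0).
  split=> // z z1.
  rewrite (@eq_PS _ _ (fun m => if m == 0%N then gamma%:C else 0)); last first.
    by move=> [|m]; rewrite /= ?mulr0 // op_weight0 mulr1.
  by rewrite PS_const.
have := analytic_class_growth lambda_ge0 lambda_lt_gamma gamma_le_delta id_pos (@normc1 R).
move=> /(_ t); rewrite t0 t1 => /(_ isT).
rewrite mulr1 PS_const ?normc_real ?ger0_norm //= => h.
by rewrite /growth_bound; apply: le_trans (ler_wpM2l t0 h) _; rewrite mulr1 ltW.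
Unshelve. all: by end_near. Qed.

Lemma growth_bound_gt (v : R) : v < ext_value -> exists2 t, 0 <= t < 1 & v < L t.
Proof.
move=> vD; have e0 : 0 < ext_value - v by rewrite subr_gt0.
have h : \forall t \near 1^'-, `|ext_value - L t| < ext_value - v.
  by move/cvgrPdist_lt: growth_bound_cvg; apply.
near (1 : R)^'- => t; exists t.
  by apply/andP; split; near: t; [exact: nbhs_left_ge|exact: nbhs_left_lt].
have ht : `|ext_value - L t| < ext_value - v by near: t.
by have := le_lt_trans (ler_norm _) ht; lra.
Unshelve. all: by end_near. Qed.

End extremal_value.

(** * The radius equation *)

Section extended_series.
Variable R : realType.
Implicit Types (x c : nat -> R).

Lemma eseries_EFin x (l : R) : (fun n => \sum_(2 <= m < n) x m) @ \oo --> l ->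
  (\sum_(2 <= m <oo) (x m)%:E)%E = l%:E.
Proof.
move=> xl; rewrite (_ : (fun n => _) = EFin \o (fun n => \sum_(2 <= m < n) x m)).
  by rewrite EFin_lim ?(cvg_lim _ xl) //; exact: cvgP xl.
by apply/funext => n /=; rewrite sumEFin.
Qed.

Lemma lee_nneseries_from2 (u v : nat -> \bar R) :
  (forall i, (2 <= i)%N -> 0 <= u i)%E -> (forall i, (2 <= i)%N -> u i <= v i)%E ->
  (\sum_(2 <= i <oo) u i <= \sum_(2 <= i <oo) v i)%E.
Proof.
move=> u0 uv; apply: lee_lim.
- by apply: is_cvg_nneseries => n h _; exact: u0.
- by apply: is_cvg_nneseries => n h _; exact: le_trans (u0 _ h) (uv _ h).
apply: nearW => n; rewrite big_nat_cond [leRHS]big_nat_cond; apply: lee_sum => i.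
by rewrite andbT => /andP[/uv].
Qed.

Lemma eq_eseries_from2 (u v : nat -> \bar R) : (forall i, (2 <= i)%N -> u i = v i) ->
  (\sum_(2 <= i <oo) u i = \sum_(2 <= i <oo) v i)%E.
Proof.
move=> uv; congr (limn _); apply/funext => n.
by apply: eq_big_nat => i /andP[/uv].
Qed.

Lemma disk_coefs01 c : (forall m, 0 <= c m <= 1) -> disk_coefs (fun m => (c m)%:C).
Proof.
move=> c01; apply: (disk_coefs_bounded (K := 1)) => m.
by have /andP[h1 h2] := c01 m; rewrite normc_real ger0_norm.
Qed.

Lemma Re_PS_cvg c t : (forall m, 0 <= c m <= 1) -> 0 <= t < 1 ->
  (fun n => \sum_(m < n) c m * t ^+ m) @ \oo --> complex.Re (PS (fun m => (c m)%:C) t%:C).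
Proof.
move=> c01 /andP[t0 t1]; have z1 : normc (t%:C : R[i]) < 1 by rewrite normc_real ger0_norm.
have := has_sum_Re (has_sum_PS (disk_coefs01 c01) z1).
rewrite (_ : series _ = (fun n => \sum_(m < n) c m * t ^+ m)) //.
transitivity (series (fun m => c m * t ^+ m)).
  by congr series; apply/funext => m; rewrite -realcX -rmorphM.
by apply/funext => n; rewrite /series /= big_mkord.
Qed.

Lemma partial_sum_le_PS c t n : (forall m, 0 <= c m <= 1) -> 0 <= t < 1 ->
  \sum_(m < n) c m * t ^+ m <= complex.Re (PS (fun m => (c m)%:C) t%:C).
Proof.
move=> c01 t01; have t0 := (andP t01).1.
apply: (cvgr_to_ge (Re_PS_cvg c01 t01)); near=> k.
have nk : (n <= k)%N by near: k; exact: nbhs_infty_ge.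
rewrite -(subnKC nk) big_split_ord /= lerDl sumr_ge0 // => i _.
by rewrite mulr_ge0 ?exprn_ge0 //; have /andP[] := c01 (n + i)%N.
Unshelve. all: by end_near. Qed.

Lemma Re_PS_le c s t : (forall m, 0 <= c m <= 1) -> 0 <= s -> s <= t -> t < 1 ->
  complex.Re (PS (fun m => (c m)%:C) s%:C) <= complex.Re (PS (fun m => (c m)%:C) t%:C).
Proof.
move=> c01 s0 st t1; have t0 : 0 <= t by exact: le_trans st.
have s01 : 0 <= s < 1 by rewrite s0 (le_lt_trans st).
have t01 : 0 <= t < 1 by rewrite t0.
apply: (cvgr_to_le (Re_PS_cvg c01 s01)); near=> n.
apply: le_trans (partial_sum_le_PS n c01 t01); apply: ler_sum => m _.
by rewrite ler_wpM2l ?lerXn2r ?nnegrE //; have /andP[] := c01 m.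
Unshelve. all: by end_near. Qed.

Lemma eseries_PS c x t : (forall m, 0 <= c m <= 1) -> c 0%N = 0 -> c 1%N = 0 ->
  0 <= t < 1 -> (forall m, (2 <= m)%N -> x m = c m * t ^+ m) ->
  (\sum_(2 <= m <oo) (x m)%:E)%E = (complex.Re (PS (fun m => (c m)%:C) t%:C))%:E.
Proof.
move=> c01 c0 c1 t01 xE; apply: eseries_EFin.
have := Re_PS_cvg c01 t01; rewrite -(cvg_shiftn 2) -[X in _ -> X](cvg_shiftn 2).
rewrite (_ : [sequence _]_n = [sequence \sum_(2 <= m < n + 2) x m]_n) //.
apply/funext => n; rewrite /= addn2 !big_ord_recl !big_add1 /= big_mkord.
by rewrite c0 c1 !mul0r !add0r; apply: eq_bigr => i _; rewrite xE.
Qed.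

End extended_series.

Section radius.
Variables (R : realType) (gamma delta lambda p : R).
Hypotheses (lambda_ge0 : 0 <= lambda) (lambda_lt_gamma : lambda < gamma)
  (gamma_le_delta : gamma <= delta) (p_ge1 : 1 <= p).
Implicit Types (r t : R).

Notation W := (op_weight gamma delta).
Notation ec := (ext_coef gamma delta lambda).
Notation D := (ext_value gamma delta lambda).

Definition coef_bound m : R := 4 * (gamma - lambda) / denom gamma delta m.

(** The bounds are the moduli of the extremal coefficients. *)
Lemma coef_boundE k : (0 < k)%N -> coef_bound k.+1 = (-1) ^+ k * ec k.
Proof.
move=> k0; rewrite /coef_bound denomE /ext_coef /ext_op gtn_eqF //.
have w0 := op_weight_gt0 lambda_ge0 lambda_lt_gamma gamma_le_delta k.
have s2 : (-1) ^+ k * (-1) ^+ k = 1 :> R by rewrite -exprMn mulrNN mulr1 expr1n.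
move: ((-1) ^+ k) s2 => s s2; transitivity (s * s * (2 * (gamma - lambda) / W k)).
  by rewrite s2; field; rewrite gt_eqF.
by field; rewrite gt_eqF.
Qed.

Lemma denom_ge0 m : 0 <= denom gamma delta m.
Proof.
case: m => [|k]; first by rewrite /denom expr0n mul0r.
by rewrite denomE mulr_ge0 // ltW // (op_weight_gt0 lambda_ge0 lambda_lt_gamma).
Qed.

Lemma coef_bound_ge0 m : 0 <= coef_bound m.
Proof. by rewrite divr_ge0 ?denom_ge0 // mulr_ge0 // subr_ge0 ltW. Qed.

(** Truncation to the indices from 2 on, where the series of the radius equation
    start. *)
Definition trunc_bound m : R := if (m < 2)%N then 0 else coef_bound m.

Lemma trunc_bound_ge0 m : 0 <= trunc_bound m.
Proof. by rewrite /trunc_bound; case: ifP => // _; exact: coef_bound_ge0. Qed.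

Lemma trunc_boundE k : (0 < k)%N -> trunc_bound k.+1 = `|ec k|.
Proof.
move=> k0; rewrite /trunc_bound ltnS ltnNge k0 /= -[LHS]ger0_norm ?coef_bound_ge0 //.
by rewrite coef_boundE // normrM normrX normrN1 expr1n mul1r.
Qed.

Lemma trunc_bound_le1 m : trunc_bound m <= 1.
Proof.
case: m => [|[|k]]; rewrite ?ler01 // trunc_boundE //.
apply: le_trans (ext_coef_le lambda_ge0 lambda_lt_gamma gamma_le_delta _) _.
rewrite ler_pdivrMr ?exprn_gt0 // mul1r expr2.
have : 2 <= k.+2%:R :> R by rewrite ler_nat.
by move: (k.+2%:R) => x x2; nra.
Qed.

Lemma sum_trunc_bound_le n : \sum_(m < n) trunc_bound m <= 4.
Proof.
case: n => [|[|n]]; rewrite ?big_ord0 // ?big_ord1 //.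
rewrite big_ord_recl /= {1}/trunc_bound /= add0r.
apply: le_trans (sum_norm_ext_coef_le lambda_ge0 lambda_lt_gamma gamma_le_delta n.+1).
by apply: ler_sum => -[[|i] hi] _; [rewrite /trunc_bound /= | rewrite -trunc_boundE].
Qed.

Definition trunc_bound_pow m : R := trunc_bound m `^ p.

Lemma p_gt0 : 0 < p. Proof. exact: lt_le_trans p_ge1. Qed.

Lemma powR_le_id (x : R) : 0 <= x <= 1 -> x `^ p <= x.
Proof.
move=> /andP[x0 x1]; have [->|xn0] := eqVneq x 0; first by rewrite powR0 // gt_eqF // p_gt0.
by apply: ge1r_powR => //; rewrite x1 lt_neqAle eq_sym xn0 x0.
Qed.

Lemma trunc_bound01 m : 0 <= trunc_bound m <= 1.
Proof. by rewrite trunc_bound_ge0 trunc_bound_le1. Qed.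

Lemma trunc_bound_pow01 m : 0 <= trunc_bound_pow m <= 1.
Proof.
rewrite powR_ge0 /=; apply: le_trans (powR_le_id (trunc_bound01 m)) _.
exact: trunc_bound_le1.
Qed.

(** This makes the second series a power series in [r `^ p]. *)
Lemma trunc_bound_powXn m r : 0 <= r ->
  (trunc_bound m * r ^+ m) `^ p = trunc_bound_pow m * (r `^ p) ^+ m.
Proof.
move=> r0; rewrite powRM ?trunc_bound_ge0 ?exprn_ge0 //; congr (_ * _).
by rewrite -[in LHS]powR_mulrn // powRAC powR_mulrn // powR_ge0.
Qed.

Definition radius_fun r : R :=
  r + complex.Re (PS (fun m => (trunc_bound m)%:C) r%:C) +
      complex.Re (PS (fun m => (trunc_bound_pow m)%:C) (r `^ p)%:C).

Lemma powR_lt1 r : 0 <= r < 1 -> 0 <= r `^ p < 1.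
Proof.
move=> /andP[r0 r1]; rewrite powR_ge0 /= (le_lt_trans _ r1) //.
by rewrite powR_le_id // r0 ltW.
Qed.

(** The left-hand side of the radius equation with the factor inside the sum; it
    is kept in the extended reals for termwise comparison with the Bohr
    inequality. *)
Definition radius_sum r : \bar R :=
  (r%:E + \sum_(2 <= m <oo) (coef_bound m * r ^+ m)%:E
    + \sum_(2 <= m <oo) ((coef_bound m * r ^+ m) `^ p)%:E)%E.

Lemma radius_sumE r : 0 <= r < 1 -> radius_sum r = (radius_fun r)%:E.
Proof.
move=> r01; have [r0 r1] := andP r01.
have sE m : (2 <= m)%N -> coef_bound m = trunc_bound m.
  by move=> m2; rewrite /trunc_bound ltnNge m2.
rewrite /radius_sum /radius_fun !EFinD; congr (_ + _ + _)%E.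
  by apply: (eseries_PS trunc_bound01) => // m /sE ->.
apply: (eseries_PS trunc_bound_pow01) => //.
- by rewrite /trunc_bound_pow /trunc_bound /= powR0 // gt_eqF // p_gt0.
- by rewrite /trunc_bound_pow /trunc_bound /= powR0 // gt_eqF // p_gt0.
- exact: powR_lt1.
- by move=> m /sE ->; exact: trunc_bound_powXn.
Qed.

Lemma radius_equationP r : 0 <= r ->
  radius_equation gamma delta lambda p r <-> radius_sum r = D%:E.
Proof.
move=> r0; rewrite /radius_equation /radius_sum -nneseriesZl; last first.
  by move=> i _; rewrite lee_fin divr_ge0 ?exprn_ge0 ?denom_ge0.
rewrite (@eq_eseries_from2 _ (fun m => (_ * (r ^+ m / _)%:E)%E)
  (fun m => (coef_bound m * r ^+ m)%:E)); last first.
  by move=> m _; rewrite -EFinM /coef_bound; congr (_%:E); ring.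
rewrite (@eq_eseries_from2 _ (fun m => ((_ * r ^+ m / _) `^ p)%:E)
  (fun m => ((coef_bound m * r ^+ m) `^ p)%:E)); last first.
  by move=> m _; rewrite /coef_bound mulrAC.
set c := 4 * (gamma - lambda).
have c0 : 0 < c by rewrite mulr_gt0 // subr_gt0.
have -> : (\sum_(2 <= m <oo) ((-1) ^+ m.-1 / denom gamma delta m)%:E)%E = ((D - 1) / c)%:E.
  apply: eseries_EFin; rewrite -(cvg_shiftn 2).
  have h : [sequence series ec (n + 1)%N]_n @ \oo --> D.
    by rewrite cvg_shiftn; exact: ext_value_cvg.
  rewrite (_ : [sequence _]_n = (fun n => (series ec (n + 1)%N - 1) / c)).
    by apply: cvgMr_tmp; apply: (cvgB h); exact: cvg_cst.
  apply/funext => n /=; rewrite addn2 addn1 /series /= big_mkord !big_add1 /= big_mkord.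
  rewrite big_ord_recl {1}/ext_coef {1}/ext_op /= op_weight0 divff; last first.
    by rewrite gt_eqF // (gamma_gt0 lambda_ge0 lambda_lt_gamma).
  rewrite addrC addKr mulr_suml; apply: eq_bigr => i _.
  have s2 : (-1) ^+ i.+1 * (-1) ^+ i.+1 = 1 :> R by rewrite -exprMn mulrNN mulr1 expr1n.
  have e : ec i.+1 = (-1) ^+ i.+1 * coef_bound i.+2.
    by rewrite coef_boundE // mulrA s2 mul1r.
  rewrite (_ : bump 0 i = i.+1) // e /coef_bound -/c; have d0 : denom gamma delta i.+2 != 0.
    by rewrite denomE mulf_neq0 // gt_eqF // (op_weight_gt0 lambda_ge0 lambda_lt_gamma).
  by field; rewrite d0 gt_eqF.
have -> : (1 + c%:E * ((D - 1) / c)%:E)%E = D%:E.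
  by rewrite -EFinM -EFinD; congr (_%:E); field; rewrite gt_eqF.
by [].
Qed.

Lemma radius_fun_cont (a b : R) : 0 < a -> b < 1 -> {within `[a, b], continuous radius_fun}.
Proof.
move=> a0 b1.
have cG c (t : R) : (forall m, 0 <= c m <= 1) -> 0 <= t -> t < 1 ->
    {for t, continuous (fun s : R => complex.Re (PS (fun m => (c m)%:C) s%:C))}.
  move=> c01 t0 t1; have h : normc (0 + t%:C * 1 : R[i]) < 1.
    by rewrite add0r mulr1 normc_real ger0_norm.
  have [dv _] := PS_line_derive 1 (disk_coefs01 c01) h.
  rewrite (_ : (fun s : R => _) = (fun s : R => complex.Re (1 * PS (fun m => (c m)%:C) (0 + s%:C * 1)))).
    exact/differentiable_continuous/derivable1_diffP.
  by apply/funext => s; rewrite mul1r add0r mulr1.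
apply: continuous_in_subspaceT => t; rewrite inE /= in_itv /= => /andP[ha hb].
have t0 : 0 < t by exact: lt_le_trans ha.
have t1 : t < 1 by exact: le_lt_trans b1.
have /andP[q0 q1] : 0 <= t `^ p < 1 by apply: powR_lt1; rewrite (ltW t0).
apply: cvgD.
  by apply: cvgD; [exact: cvg_id | exact: cG trunc_bound01 (ltW t0) t1].
apply: (@continuous_comp _ _ _ (fun s : R => s `^ p)
  (fun s : R => complex.Re (PS (fun m => (trunc_bound_pow m)%:C) s%:C))).
  apply/differentiable_continuous/derivable1_diffP/derivable_powR.
  by rewrite in_itv /= t0.
exact: cG trunc_bound_pow01 q0 q1.
Qed.

(** Crude, but enough for small [t]: each of the two series is at most [t] times
    the sum of the bounds, since powers with exponent [p >= 1] do not increase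
    numbers of the unit interval. *)
Lemma radius_fun_le t : 0 < t < 1 -> radius_fun t <= 9 * t.
Proof.
move=> /andP[t0 t1].
have bd (c : nat -> R) (s : R) : (forall m, 0 <= c m <= 1) -> 0 <= s < 1 ->
    (forall n, \sum_(m < n) c m * s ^+ m <= 4 * t) ->
    complex.Re (PS (fun m => (c m)%:C) s%:C) <= 4 * t.
  move=> c01 /andP[s0 s1] hB; apply: le_trans (Re_le_normc _) _.
  have dc := disk_coefs01 c01.
  have z1 : normc (s%:C : R[i]) < 1 by rewrite normc_real ger0_norm.
  apply: has_sum_norm_le (has_sum_PS dc z1) _ => n; apply: le_trans (hB n).
  apply: ler_sum => m _; rewrite -realcX -rmorphM normc_real ger0_norm //.
  by rewrite mulr_ge0 ?exprn_ge0 //; have /andP[] := c01 m.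
have tm m : trunc_bound m * t ^+ m <= trunc_bound m * t.
  case: m => [|m]; first by rewrite /trunc_bound !mul0r.
  rewrite ler_wpM2l ?trunc_bound_ge0 // exprS ler_piMr ?(ltW t0) //.
  by rewrite exprn_ile1 // ltW.
have h1 : complex.Re (PS (fun m => (trunc_bound m)%:C) t%:C) <= 4 * t.
  apply: bd trunc_bound01 _ _ => [|n]; first by rewrite (ltW t0).
  apply: (@le_trans _ _ (\sum_(m < n) trunc_bound m * t)); first by apply: ler_sum.
  by rewrite -mulr_suml ler_wpM2r ?sum_trunc_bound_le // ltW.
have h2 : complex.Re (PS (fun m => (trunc_bound_pow m)%:C) (t `^ p)%:C) <= 4 * t.
  apply: bd trunc_bound_pow01 _ _ => [|n]; first by apply: powR_lt1; rewrite (ltW t0).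
  apply: (@le_trans _ _ (\sum_(m < n) trunc_bound m * t)).
    apply: ler_sum => m _; rewrite -trunc_bound_powXn ?(ltW t0) //.
    apply: le_trans (tm m); apply: powR_le_id.
    rewrite mulr_ge0 ?trunc_bound_ge0 ?exprn_ge0 ?(ltW t0) //=.
    apply: le_trans (tm m) _.
    by rewrite mulr_ile1 ?trunc_bound_ge0 ?trunc_bound_le1 ?(ltW t0) // ltW.
  by rewrite -mulr_suml ler_wpM2r ?sum_trunc_bound_le // ltW.
have -> : 9 * t = t + 4 * t + 4 * t by ring.
exact: lerD (lerD (lexx t) h1) h2.
Qed.

Lemma radius_fun_lt (s t : R) : 0 <= s -> s < t -> t < 1 -> radius_fun s < radius_fun t.
Proof.
move=> s0 st t1; have t0 : 0 <= t by exact: le_trans (ltW st).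
have t01 : 0 <= t < 1 by rewrite t0.
have [q0 q1] := andP (powR_lt1 t01).
have h1 := Re_PS_le trunc_bound01 s0 (ltW st) t1.
have sp : s `^ p <= t `^ p by rewrite ge0_ler_powR ?nnegrE // ltW // p_gt0.
have h2 := Re_PS_le trunc_bound_pow01 (powR_ge0 s p) sp q1.
exact: ltr_leD (ltr_leD st h1) h2.
Qed.

Lemma radius_fun_ge t : 0 <= t < 1 -> t + coef_bound 2 * t ^+ 2 <= radius_fun t.
Proof.
move=> t01; have := partial_sum_le_PS 3 trunc_bound01 t01.
rewrite !big_ord_recl big_ord0 {1 2 3}/trunc_bound /= !mul0r !add0r addr0 => h1.
have := partial_sum_le_PS 0 trunc_bound_pow01 (powR_lt1 t01); rewrite big_ord0 => h2.
by rewrite -[leLHS]addr0; exact: lerD (lerD (lexx t) h1) h2.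
Qed.

(** Near 0 the left-hand side is small. Near 1 it exceeds 1, hence [D]: the term
    [coef_bound 2 * t ^+ 2] outweighs the gap [1 - t]. The interval
    starts at a positive [a], where the real power is differentiable. *)
Lemma radius_root_exists : exists r : R, is_radius_root gamma delta lambda p r.
Proof.
have D0 := ext_value_gt0 lambda_ge0 lambda_lt_gamma gamma_le_delta.
have D1 := ext_value_le1 lambda_ge0 lambda_lt_gamma gamma_le_delta.
set D' := ext_value _ _ _ in D0 D1.
pose a := Num.min (4^-1) (D' / 9).
have a0 : 0 < a by rewrite lt_min invr_gt0 ltr0n divr_gt0.
have a4 : a <= 4^-1 by rewrite ge_min lexx.
have a9 : 9 * a <= D' by rewrite mulrC -ler_pdivlMr // ge_min lexx orbT.
have c2 : 0 < coef_bound 2.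
  have w0 := op_weight_gt0 lambda_ge0 lambda_lt_gamma gamma_le_delta 1.
  have d0 : 0 < denom gamma delta 2 by rewrite denomE mulr_gt0.
  by rewrite /coef_bound divr_gt0 // mulr_gt0 // subr_gt0.
(* With [d <= 1/2] the square of [1 - d] is at least 1/4, so the quadratic term is
   at least [coef_bound 2 / 4], hence at least [d]. *)
pose d := Num.min (2^-1) (coef_bound 2 / 4).
have d0 : 0 < d by rewrite lt_min invr_gt0 ltr0n divr_gt0.
have d2 : d <= 2^-1 by rewrite ge_min lexx.
have dc : d <= coef_bound 2 / 4 by rewrite ge_min lexx orbT.
have ab : a <= 1 - d by lra.
have b1 : 1 - d < 1 by lra.
have a01 : 0 < a < 1 by apply/andP; split; lra.
have d01 : 0 <= 1 - d < 1 by apply/andP; split; lra.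
have hc : 1 <= 1 - d + coef_bound 2 * (1 - d) ^+ 2.
  have : 4^-1 <= (1 - d) ^+ 2 by rewrite expr2; nra.
  by move=> /(ler_wpM2l (ltW c2)); lra.
have ha : radius_fun a <= D' by exact: le_trans (radius_fun_le a01) a9.
have hb : D' <= radius_fun (1 - d).
  exact: le_trans (le_trans D1 hc) (radius_fun_ge d01).
have [|r] := IVT ab (radius_fun_cont a0 b1) (v := D').
  apply/andP; split; first by rewrite ge_min; apply/orP; left; exact: ha.
  by rewrite le_max; apply/orP; right; exact: hb.
rewrite in_itv /= => /andP[ar rb] hr; exists r.
have r0 : 0 < r by exact: lt_le_trans ar.
have r1 : r < 1 by exact: le_lt_trans b1.
split; first by rewrite r0.
by apply/(radius_equationP (ltW r0)); rewrite radius_sumE ?(ltW r0) // hr.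
Qed.

Lemma radius_root_unique r r' : is_radius_root gamma delta lambda p r ->
  is_radius_root gamma delta lambda p r' -> r = r'.
Proof.
move=> [/andP[r0 r1] /(radius_equationP (ltW r0))].
rewrite radius_sumE ?(ltW r0) // => -[h] [/andP[r0' r1'] /(radius_equationP (ltW r0'))].
rewrite radius_sumE ?(ltW r0') // => -[h'].
have [lt|lt|//] := ltgtP r r'.
  by have := radius_fun_lt (ltW r0) lt r1'; rewrite h h' ltxx.
by have := radius_fun_lt (ltW r0') lt r1; rewrite h h' ltxx.
Qed.

End radius.

(** * The Bohr inequality *)

Section bohr.
Variables (R : realType) (gamma delta lambda p : R).
Hypotheses (lambda_ge0 : 0 <= lambda) (lambda_lt_gamma : lambda < gamma)
  (gamma_le_delta : gamma <= delta) (p_ge1 : 1 <= p).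
Variables (f h g : R[i]^o -> R[i]^o) (a b : nat -> R[i]).
Hypotheses (hf : class_RH0 gamma delta lambda f h g)
  (ha : power_coefs 1 a h) (hb : power_coefs 0 b g).
Implicit Types (z w u v : R[i]) (t : R).

Notation L := (growth_bound gamma delta lambda).
Notation D := (ext_value gamma delta lambda).

(** The radius [t] is chosen so that the growth bound on the circle exceeds the
    modulus of [v]. *)
Lemma class_covers v : normc v < D -> exists2 z, normc z < 1 & f z = v.
Proof.
move=> vD; have [t t01 vL] := growth_bound_gt lambda_ge0 lambda_lt_gamma gamma_le_delta vD.
have [t0 t1] := andP t01.
have tgt0 : 0 < t.
  rewrite lt_neqAle eq_sym t0 andbT; apply/eqP => tE.
  have := le_lt_trans (normc_ge0 v) vL; rewrite tE /growth_bound mul0r ltxx //.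
have [dA _] := power_coefs_PS ha; have [dB _] := power_coefs_PS hb.
have [z zt fz] : exists2 z, normc z <= t & f z = v.
  apply: (covering dA dB t01) => [z z1|z z1|z zt].
  - exact: (class_fE hf ha hb z1).
  - by apply: (class_jacobian lambda_ge0 lambda_lt_gamma gamma_le_delta hf ha hb).
  have [w w1 zE] := polarP z; rewrite zt in zE; rewrite zE.
  rewrite [conjc _]conjcM conjc_real -mulrA Re_mulrc mulrC ltr_pM2l //.
  apply: lt_le_trans vL _.
  exact: (class_growth lambda_ge0 lambda_lt_gamma gamma_le_delta hf ha hb w1 t01).
by exists z => //; exact: le_lt_trans t1.
Qed.

Lemma nbhs_normc (v : R[i]^o) (e : R) : 0 < e ->
  nbhs v [set v' : R[i]^o | normc (v - v') < e].
Proof.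
move=> e0; apply/nbhs_ballP; exists e%:C => /=; first by rewrite ltcR.
by move=> v'; rewrite -ball_normE /ball_ /= normcE ltcR.
Qed.

(** A boundary point in the open disk of radius [D] would be interior, as the
    disk is covered. *)
Lemma class_dist_ge : (D%:E <= dist_to (f 0%R) (boundary (f @` unit_disk (R := R))%classic))%E.
Proof.
have f0 : f 0 = 0.
  have [[fE _ _ [h0 _] [g0 _]] _] := hf.
  have d0 : unit_disk (0 : R[i]^o) by rewrite /unit_disk /mkset normc0.
  by rewrite (fE 0 d0) h0 g0 conjc0 addr0.
apply: le_ereal_inf_tmp => _ [v [_ vint] <-]; rewrite f0 subr0 lee_fin leNgt.
apply/negP => vD; apply: vint.
have e0 : 0 < D - normc v by rewrite subr_gt0.
apply: filterS (nbhs_normc v e0) => v' /= hv'.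
have [z z1 fz] : exists2 z, normc z < 1 & f z = v'.
  apply: class_covers; have := normcB_ge v' v; rewrite normcB => h1; lra.
by exists z.
Qed.

Lemma class_coef_bound m : (2 <= m)%N ->
  normc (a m) + normc (b m) <= coef_bound gamma delta lambda m.
Proof.
case: m => [|[|k]] // _.
have w0 := op_weight_gt0 lambda_ge0 lambda_lt_gamma gamma_le_delta k.+1.
have := class_coef_le lambda_ge0 lambda_lt_gamma gamma_le_delta hf ha hb (ltn0Sn k).
rewrite /coef_bound denomE -ler_pdivlMl // => h1.
apply: le_trans h1 _; rewrite le_eqVlt; apply/orP; left; apply/eqP.
by field; rewrite gt_eqF.
Qed.

Lemma class_bohr (r : R) z : is_radius_root gamma delta lambda p r ->
  normc z <= r -> bohr_inequality p f a b z.
Proof.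
move=> [/andP[r0 r1] req] zr; rewrite /bohr_inequality.
apply: le_trans class_dist_ge.
have <- := iffLR (radius_equationP p lambda_ge0 lambda_lt_gamma gamma_le_delta (ltW r0)) req.
have z0 := normc_ge0 z; have p0 : 0 < p := p_gt0 p_ge1.
have c0 m := coef_bound_ge0 lambda_ge0 lambda_lt_gamma gamma_le_delta m.
have s0 m : 0 <= normc (a m) + normc (b m) by rewrite addr_ge0 ?normc_ge0.
have term m : (2 <= m)%N -> (normc (a m) + normc (b m)) * normc z ^+ m <=
    coef_bound gamma delta lambda m * r ^+ m.
  move=> m2; apply: ler_pM; rewrite ?exprn_ge0 ?class_coef_bound //.
  by rewrite lerXn2r ?nnegrE // ltW.
rewrite /radius_sum; apply: leeD; first apply: leeD.
- by rewrite lee_fin.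
- apply: lee_nneseries_from2 => m m2; rewrite lee_fin; last exact: term.
  by rewrite mulr_ge0 ?exprn_ge0.
apply: lee_nneseries_from2 => m m2; rewrite lee_fin.
  by rewrite mulr_ge0 ?powR_ge0.
have -> : (normc (a m) + normc (b m)) `^ p * normc z `^ (p * m%:R) =
    ((normc (a m) + normc (b m)) * normc z ^+ m) `^ p.
  by rewrite powRM ?exprn_ge0 // [p * _]mulrC powRrM powR_mulrn.
have n1 := mulr_ge0 (s0 m) (exprn_ge0 m z0).
have n2 := mulr_ge0 (c0 m) (exprn_ge0 m (ltW r0)).
exact: (ge0_ler_powR (ltW p0) n1 n2 (term m m2)).
Qed.

End bohr.

(** * Sharpness *)

Section sharpness.
Variables (R : realType) (gamma delta lambda p : R).
Hypotheses (lambda_ge0 : 0 <= lambda) (lambda_lt_gamma : lambda < gamma)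
  (gamma_le_delta : gamma <= delta) (p_ge1 : 1 <= p).
Implicit Types (z w u v : R[i]) (t : R).

Notation L := (growth_bound gamma delta lambda).
Notation D := (ext_value gamma delta lambda).
Notation c := (ext_fun_coef gamma delta lambda).

Definition extremal : R[i]^o -> R[i]^o := PS c.

Lemma disk_coefs0 : disk_coefs (fun=> 0 : R[i]).
Proof. by apply: (disk_coefs_bounded (K := 0)) => m; rewrite normc0. Qed.

Lemma PS0 z : normc z < 1 -> PS (fun=> 0) z = 0.
Proof.
move=> z1; rewrite -[RHS](PS_const 0 z1); apply: eq_PS => m.
by case: ifP.
Qed.

Lemma normc0_lt1 : normc (0 : R[i]) < 1. Proof. by rewrite normc0. Qed.

Lemma PS_at0 (d : nat -> R[i]) : disk_coefs d -> PS d 0 = d 0%N.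
Proof. by move=> dd; rewrite (PS_cons dd normc0_lt1) mul0r addr0. Qed.

Lemma ext_coef0 : ext_coef gamma delta lambda 0 = 1.
Proof.
rewrite /ext_coef /ext_op eqxx op_weight0 divff // gt_eqF //.
exact: (gamma_gt0 lambda_ge0 lambda_lt_gamma).
Qed.

Let dc := disk_coefs_ext_fun_coef lambda_ge0 lambda_lt_gamma gamma_le_delta.

Lemma extremal_class : class_RH0 gamma delta lambda extremal extremal (fun=> 0).
Proof.
have hE z : normc z < 1 -> extremal z = PS c z by [].
have gE z : normc z < 1 -> (fun=> 0 : R[i]^o) z = PS (fun=> 0) z by move=> /PS0.
split.
  split=> [z z1|z z1|z z1||].
  - by rewrite conjc0 addr0.
  - exact: (PS_derive1 dc hE z1).1.
  - exact: (PS_derive1 disk_coefs0 gE z1).1.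
  - rewrite (PS_derive1 dc hE normc0_lt1).2 PS_at0; last exact: disk_coefs_dcoef.
    by rewrite hE ?normc0_lt1 // PS_at0 // /dcoef /= ext_coef0 mul1r rmorph1 subrr.
  rewrite (PS_derive1 disk_coefs0 gE normc0_lt1).2 PS_at0; last exact: disk_coefs_dcoef disk_coefs0.
  by rewrite /dcoef mulr0.
move=> z z1; rewrite (third_order_op_PS _ _ disk_coefs0 gE z1) (third_order_op_PS _ _ dc hE z1).
rewrite (eq_PS z (b := fun=> 0)); last by move=> m; rewrite mulr0.
rewrite PS0 // normc0 ReB subr_gt0.
have [_ _ hpos] := analytic_class_ext lambda_ge0 lambda_lt_gamma gamma_le_delta.
exact: hpos.
Qed.

Lemma extremal_coefs : power_coefs 1 c extremal.
Proof.
apply/power_coefsP => z z1; apply: has_sum_ext (has_sum_PS dc z1) => -[|[|m]] //.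
by rewrite /= ext_coef0 rmorph1.
Qed.

Lemma zero_coefs : power_coefs 0 (fun=> 0 : R[i]) (fun=> 0 : R[i]^o).
Proof.
apply/power_coefsP => z z1; rewrite -[X in has_sum _ X](PS0 z1).
by apply: has_sum_ext (has_sum_PS disk_coefs0 z1) => -[|[|m]].
Qed.

Lemma extremal_real t : 0 <= t < 1 -> extremal t%:C = (L t)%:C.
Proof.
move=> t01; have [t0 t1] := andP t01.
have z1 : normc (t%:C : R[i]) < 1 by rewrite normc_real ger0_norm.
have h := has_sum_Re (has_sum_PS dc z1).
rewrite (growth_boundE lambda_ge0 lambda_lt_gamma gamma_le_delta t01).
apply: PSE => //; apply/has_sumP => e e0; near=> n.
pose x m : R := complex.Re (c m).
have cE m : c m = (x m)%:C by case: m.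
have -> : (complex.Re (PS c t%:C))%:C - \sum_(k < n) c k * t%:C ^+ k =
   (complex.Re (PS c t%:C) - series (fun k => complex.Re (c k * t%:C ^+ k)) n)%:C.
  rewrite rmorphB /series /= big_mkord rmorph_sum; congr (_ - _); apply: eq_bigr => k _.
  have e1 : c k * t%:C ^+ k = (x k * t ^+ k)%:C
    by rewrite rmorphM rmorphXn; congr (_ * _); exact: cE.
  by rewrite e1.
rewrite normc_real; near: n.
by move/cvgrPdist_lt: h; apply.
Unshelve. all: by end_near. Qed.

(** If the value were attained at [z], monotonicity between [z] and a point [x] of
    the positive axis closer to 1 would give [extremal x > D]. *)
Lemma extremal_omits z : normc z < 1 -> extremal z != D%:C.
Proof.
move=> z1; apply/eqP => fz.
(* The midpoint of 1 and the positive part of [Re z]. *)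
pose x := (1 + Num.max 0 (complex.Re z)) / 2.
have rz : complex.Re z < 1 by exact: le_lt_trans (Re_le_normc z) z1.
have m0 : 0 <= Num.max 0 (complex.Re z) by rewrite le_max lexx.
have m1 : Num.max 0 (complex.Re z) < 1 by rewrite gt_max ltr01.
have mz : complex.Re z <= Num.max 0 (complex.Re z) by rewrite le_max lexx orbT.
have x01 : 0 <= x < 1 by rewrite /x; apply/andP; split; lra.
have xz : 0 < x - complex.Re z by rewrite /x; lra.
have nx : normc (x%:C : R[i]) < 1.
  by rewrite normc_real ger0_norm; [exact: (andP x01).2|exact: (andP x01).1].
have xnz : x%:C != z.
  by apply: contraTneq xz => <-; rewrite /= subrr ltxx.
have := PS_strict_mono dc
  (ext_fun_coef_deriv_gt0 lambda_ge0 lambda_lt_gamma gamma_le_delta) nx z1 xnz.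
rewrite -/(extremal x%:C) -/(extremal z) fz (extremal_real x01) -rmorphB mulrC Re_mulrc Re_conj ReB.
have := growth_bound_le_value lambda_ge0 lambda_lt_gamma gamma_le_delta x01.
rewrite -subr_le0 => h1; rewrite /= pmulr_lgt0 //.
by rewrite ltNge h1.
Qed.

(** [D] itself is a boundary point: a limit along the positive axis that is not
    attained. *)
Lemma extremal_dist_le :
  (dist_to (extremal 0%R) (boundary (extremal @` unit_disk (R := R))%classic) <= D%:E)%E.
Proof.
have f0 : extremal 0 = 0 by rewrite /extremal PS_at0.
apply: ge_ereal_inf; exists (normc (D%:C - extremal 0))%:E; last first.
  rewrite f0 subr0 lee_fin normc_real ger0_norm // ltW //.
  exact: (ext_value_gt0 lambda_ge0 lambda_lt_gamma gamma_le_delta).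
exists (D%:C : R[i]^o) => //; split; last first.
  move=> /interior_subset[z z1 /eqP]; apply/negP; exact: extremal_omits.
move=> B /nbhs_ballP[e /= e0 eB].
have e0' : 0 < complex.Re e by move: e0; rewrite ltcE => /andP[].
have h : \forall t \near 1^'-, `|D - L t| < complex.Re e.
  by move/cvgrPdist_lt: (growth_bound_cvg lambda_ge0 lambda_lt_gamma gamma_le_delta); apply.
near (1 : R)^'- => t.
have t01 : 0 <= t < 1.
  by apply/andP; split; near: t; [exact: nbhs_left_ge|exact: nbhs_left_lt].
have ht : `|D - L t| < complex.Re e by near: t.
exists (extremal t%:C); split.
  exists (t%:C : R[i]^o) => //; rewrite /unit_disk /mkset normc_real ger0_norm.
    exact: (andP t01).2.
  exact: (andP t01).1.
apply: eB; rewrite -ball_normE /ball_ /= normcE (extremal_real t01) -rmorphB normc_real.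
by rewrite ltcE /= ht andbT; move: e0; rewrite ltcE => /andP[/eqP ->].
Unshelve. all: by end_near. Qed.

Lemma radius_sharp (r rho : R) : is_radius_root gamma delta lambda p r ->
  r < rho -> ~ bohr_holds_up_to gamma delta lambda p rho.
Proof.
move=> [/andP[r0 r1] req] rrho hB.
(* A radius beyond the root that is still less than 1. *)
pose s := Num.min rho ((1 + r) / 2).
have rs : r < s by rewrite lt_min rrho /=; lra.
have s1 : s < 1 by rewrite gt_min; apply/orP; right; lra.
have srho : s <= rho by rewrite ge_min lexx.
have s0 : 0 <= s by exact: ltW (lt_trans r0 rs).
have s01 : 0 <= s < 1 by rewrite s0.
have ns : normc (s%:C : R[i]) = s by rewrite normc_real ger0_norm.
have hs : (radius_sum gamma delta lambda p s <= D%:E)%E.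
  have us : unit_disk (s%:C : R[i]^o) by rewrite /unit_disk /mkset ns.
  have nrho : normc (s%:C : R[i]) <= rho by rewrite ns.
  have := hB _ _ _ _ _ extremal_class extremal_coefs zero_coefs _ us nrho.
  rewrite /bohr_inequality ns => h1; apply: le_trans (le_trans h1 extremal_dist_le).
  have cE m : (2 <= m)%N -> normc (c m) + normc (0 : R[i]) = coef_bound gamma delta lambda m.
    case: m => [|[|k]] // _; rewrite normc0 addr0.
    have -> : c k.+2 = (ext_coef gamma delta lambda k.+1)%:C by [].
    by rewrite normc_real -(trunc_boundE lambda_ge0 lambda_lt_gamma gamma_le_delta (ltn0Sn k)).
  rewrite /radius_sum; apply: leeD; first apply: leeD => //.
    rewrite le_eqVlt; apply/orP; left; apply/eqP.
    by apply: eq_eseries_from2 => m /cE ->.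
  rewrite le_eqVlt; apply/orP; left; apply/eqP.
  apply: eq_eseries_from2 => m m2; rewrite cE //; congr (_%:E).
  rewrite powRM ?exprn_ge0 //; last exact: (coef_bound_ge0 lambda_ge0 lambda_lt_gamma).
  by rewrite [p * _]mulrC powRrM powR_mulrn.
have r01 : 0 <= r < 1 by rewrite (ltW r0).
have hr := iffLR (radius_equationP p lambda_ge0 lambda_lt_gamma gamma_le_delta (ltW r0)) req.
move: hs; rewrite -hr !radius_sumE // lee_fin leNgt => /negP; apply.
exact: (radius_fun_lt lambda_ge0 lambda_lt_gamma gamma_le_delta p_ge1 (ltW r0) rs s1).
Qed.

End sharpness.

(** * The Bohr radius *)

Theorem theorem3p1 (R : realType) (gamma delta lambda p : R)
    (lambda_ge0 : 0 <= lambda) (lambda_lt_gamma : lambda < gamma)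
    (gamma_le_delta : gamma <= delta) (p_ge1 : 1 <= p) :
  (exists! r : R, is_radius_root gamma delta lambda p r) /\
  (forall r : R, is_radius_root gamma delta lambda p r ->
     bohr_holds_up_to gamma delta lambda p r /\
     (forall rho : R, r < rho ->
        ~ bohr_holds_up_to gamma delta lambda p rho)).
Proof.
split.
  have [r hr] := radius_root_exists lambda_ge0 lambda_lt_gamma gamma_le_delta p_ge1.
  exists r; split=> // r' hr'.
  exact: (radius_root_unique lambda_ge0 lambda_lt_gamma gamma_le_delta p_ge1 hr hr').
move=> r hr; split=> [f h g a b hf ha hb z _ zr|rho].
  exact: (class_bohr lambda_ge0 lambda_lt_gamma gamma_le_delta p_ge1 hf ha hb hr zr).
exact: (radius_sharp lambda_ge0 lambda_lt_gamma gamma_le_delta p_ge1 hr).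
Qed.
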